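(* Let $k\ge 1$ be an integer and suppose that conditions $\mathcal L_1$, $\mathcal L_2$, $\mathcal L_3$ listed in the context hold for this $k$. Let $\vartheta_0\in\Theta$ be the true value. Then for every $p>1$ there exists a constant $C^*>0$, not depending on $n$, such that for all $n\ge1$ $$\Bigl|\mathbf E_{\vartheta_0}\bigl|\check\vartheta_n-\vartheta_0\bigr|^p-\mathbf E_{\vartheta_0}\bigl|\Psi_{0,n}\bigr|^p\Bigr|\le C^*\,n^{-\frac{2k+1}{4}},\qquad\text{where}\quad \Psi_{0,n}=\sum_{l=1}^k\psi_l(\vartheta_0)\,\eta_n^{\,l}\,n^{-l/2},\quad \eta_n=\eta_n(\vartheta_0).$$
   Context: Let $\Theta=(\alpha,\beta)$ be a bounded open interval of $\mathbb R$ and let $\mathcal T\subset\mathbb R$ be an interval (bounded or not). For each $\vartheta\in\Theta$ let $\lambda(\vartheta,\cdot):\mathcal T\to[0,\infty)$ be an intensity function. One observes $n$ independent inhomogeneous Poisson (counting) processes $X^{(n)}=(X_1,\dots,X_n)$, $X_j=\{X_j(t),\,t\in\mathcal T\}$, all with the same intensity function $\lambda(\vartheta_0,\cdot)$, where $\vartheta_0\in\Theta$ is the true value; $\mathbf P_{\vartheta_0}$ and $\mathbf E_{\vartheta_0}$ denote the corresponding probability and expectation. Let $g:\mathcal T\to\mathbb R$ be a given measurable function and put $$m(\vartheta)=\int_{\mathcal T}g(t)\lambda(\vartheta,t)\,dt,\qquad \bar m_n=\frac1n\sum_{j=1}^n\int_{\mathcal T}g(t)\,dX_j(t).$$ Conditions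 $\mathcal L$ (for a given integer $k\ge1$): $\mathcal L_1$: the function $m(\vartheta)$, $\vartheta\in\Theta$, has $k+2$ continuous bounded derivatives. $\mathcal L_2$: the function $m(\vartheta)$, $\vartheta\in\Theta$, is monotone and $\inf_{\vartheta\in\Theta}|\dot m(\vartheta)|>0$, where $\dot m$ is the derivative of $m$ with respect to $\vartheta$. $\mathcal L_3$: for every $q>0$, $\ \sup_{\vartheta\in\Theta}\int_{\mathcal T}|g(t)|^{q}\lambda(\vartheta,t)\,dt<\infty$. Under these conditions $m$ is regarded as a continuous function on $[\alpha,\beta]$ (extended by its limits at the endpoints), and $G$ denotes the inverse function of $m$, so that $G(m(\vartheta))=\vartheta$; $G^{(l)}$ is its $l$-th derivative. The method of moments estimator (MME) $\check\vartheta_n$ is the value of $\vartheta\in[\alpha,\beta]$ minimizing $(m(\vartheta)-\bar m_n)^2$. Thus, when $m$ is increasing, $\check\vartheta_n=\alpha$ if $\bar m_n\le m(\alpha)$, $\check\vartheta_n=G(\bar m_n)$ if $m(\alpha)<\bar m_n<m(\beta)$, and $\check\vartheta_n=\beta$ if $\bar m_n\ge m(\beta)$. Notation: $\psi_l(\vartheta_0)=\dfrac{G^{(l)}(m(\vartheta_0))}{l!}$ for $l=1,\dots,k$, and $$\eta_n(\vartheta_0)=\sqrt n\,(\bar m_n-m(\vartheta_0))=\frac1{\sqrt n}\int_{\mathcal T}g(t)\,d\pi_n(t),\qquad d\pi_n(t)=\sum_{j=1}^n dX_j(t)-n\lambda(\vartheta_0,t)\,dt.$$ *)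

(* Defs.v *)
From HB Require Import structures.
From mathcomp Require Import all_boot all_order all_algebra.
From mathcomp Require Import all_classical all_reals all_analysis.
From mathcomp Require Import measurable_realfun.

Set Implicit Arguments.
Unset Strict Implicit.
Unset Printing Implicit Defensive.

Import Order.TTheory GRing.Theory Num.Theory.
Import numFieldNormedType.Exports.

Local Open Scope classical_set_scope.
Local Open Scope ring_scope.

(* The intervals contained in some compact subinterval of [T]; they are those
   on which a counting process on [T] has finitely many events. *)
Definition subintervals (R : realType) (T : interval R) : set (interval R) :=
  [set J | exists a b : R, [set` J] `<=` `[a, b] /\ `[a, b] `<=` [set` T]].

(* Local integrability is what makes [X(t) - X(s)] finite for [s < t] in [T];
   the total intensity over [T] may be infinite. *)
Definition intensity (R : realType) (T : interval R) (f : R -> R) : Prop :=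
  [/\ measurable_fun [set` T] f,
      (forall t, t \in T -> 0 <= f t) &
      (forall J, subintervals T J ->
         \int[lebesgue_measure]_(t in [set` J]) (f t)%:E < +oo)%E].

(* For families of sigma-algebras this is the usual notion: no subfamily of
   indices is needed, since the [E i] outside of it can be taken to be the
   whole space. *)
Definition independent_families (d : measure_display) (Omega : measurableType d)
    (R : realType) (P : probability Omega R) (I : finType)
    (F : I -> set (set Omega)) : Prop :=
  forall E : I -> set Omega, (forall i, F i (E i)) ->
    (P (\bigcap_(i in [set: I]) E i) = \prod_(i : I) P (E i))%E.

(* A counting process [X(t)], [t] in [T], is represented by its random counting
   measure [dX]: [X omega [set` J]] is the number of events in [J], so that
   [X(t) - X(s)] is [X omega `]s, t]].  Nothing is required outside [T].
   [counting_sigma_algebra X Js] is the sigma-algebra generated by the counts on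
   the intervals of [Js]. *)
Definition counting_sigma_algebra (d : measure_display)
    (Omega : measurableType d) (R : realType)
    (X : Omega -> {measure set (measurableTypeR R) -> \bar R})
    (Js : set (interval R)) : set (set Omega) :=
  <<s [set E | exists J k, Js J /\
               E = [set omega | X omega [set` J] = (k%:R : R)%:E]] >>.

(* Each path is locally finite and integer-valued on [T], the increments have
   Poisson laws and are independent on disjoint intervals.  The Poisson weights
   are written out because [poisson_pmf] is 1 at rate 0, whereas the formula
   below gives the point mass at 0 there. *)
Definition poisson_process (d : measure_display) (Omega : measurableType d)
    (R : realType) (P : probability Omega R) (T : interval R) (f : R -> R)
    (X : Omega -> {measure set (measurableTypeR R) -> \bar R}) : Prop :=
  [/\ (forall omega J, subintervals T J ->
         exists k : nat, X omega [set` J] = (k%:R : R)%:E),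
      (forall J, subintervals T J ->
         measurable_fun [set: Omega] (fun omega => X omega [set` J])),
      (forall J (k : nat), subintervals T J ->
         let r := \int[lebesgue_measure]_(t in [set` J]) f t in
         P [set omega | X omega [set` J] = (k%:R : R)%:E] =
         (expR (- r) * r ^+ k / k`!%:R)%:E) &
      (forall (l : nat) (J : 'I_l -> interval R),
         (forall i, subintervals T (J i)) ->
         trivIset [set: 'I_l] (fun i => [set` J i]) ->
         independent_families P
           (fun i => counting_sigma_algebra X [set J i]))].

Definition iid_poisson_processes (d : measure_display)
    (Omega : measurableType d) (R : realType) (P : probability Omega R)
    (T : interval R) (f : R -> R) (n : nat)
    (X : 'I_n -> Omega -> {measure set (measurableTypeR R) -> \bar R}) : Prop :=
  (forall j, poisson_process P T f (X j)) /\
  independent_families P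
    (fun j => counting_sigma_algebra (X j) (subintervals T)).

Definition moment (R : realType) (T : interval R) (g : R -> R)
    (lambda : R -> R -> R) (theta : R) : R :=
  \int[lebesgue_measure]_(t in [set` T]) (g t * lambda theta t).

Definition empirical_moment (R : realType) (T : interval R) (g : R -> R)
    (Omega : Type) (n : nat)
    (X : 'I_n -> Omega -> {measure set (measurableTypeR R) -> \bar R})
    (omega : Omega) : R :=
  n%:R^-1 * \sum_(j < n) \int[X j omega]_(t in [set` T]) g t.

(* The derivatives of order 1, ..., k + 2. *)
Definition condition_L1 (R : realType) (alpha beta : R) (m : R -> R)
    (k : nat) : Prop :=
  (forall (l : nat) (theta : R), (l < k.+2)%N -> theta \in `]alpha, beta[ ->
     derivable (derive1n l m) theta 1) /\
  (forall l : nat, (0 < l <= k.+2)%N ->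
     (forall theta : R, theta \in `]alpha, beta[ ->
        {for theta, continuous (derive1n l m)}) /\
     (exists M : R, forall theta : R, theta \in `]alpha, beta[ ->
        `|derive1n l m theta| <= M)).

Definition condition_L2 (R : realType) (alpha beta : R) (m : R -> R) : Prop :=
  ({in `]alpha, beta[ &, {homo m : x y / x <= y}} \/
   {in `]alpha, beta[ &, {homo m : x y / x <= y >-> y <= x}}) /\
  0 < inf [set `|derive1 m theta| | theta in `]alpha, beta[].

Definition condition_L3 (R : realType) (alpha beta : R) (T : interval R)
    (g : R -> R) (lambda : R -> R -> R) : Prop :=
  forall q : R, 0 < q ->
    (ereal_sup [set \int[lebesgue_measure]_(t in [set` T])
                      (`|g t| `^ q * lambda theta t)%:E
               | theta in `]alpha, beta[] < +oo)%E.

(* [m] on [[alpha, beta]], with its limits as values at the endpoints. *)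
Definition endpoint_extension (R : realType) (alpha beta : R) (m : R -> R)
    (theta : R) : R :=
  if theta <= alpha then lim (m x @[x --> alpha^'+])
  else if beta <= theta then lim (m x @[x --> beta^'-])
  else m theta.

Definition inverse_moment (R : realType) (alpha beta : R) (m : R -> R) :
    R -> R :=
  'pinv_(fun=> alpha) `[alpha, beta] (endpoint_extension alpha beta m).

(* The minimizer is unique when the extension of [m] is continuous and injective
   on [[alpha, beta]]. *)
Definition mme (R : realType) (alpha beta : R) (m : R -> R) (y : R) : R :=
  let mbar := endpoint_extension alpha beta m in
  xget alpha [set theta | theta \in `[alpha, beta] /\
    forall theta' : R, theta' \in `[alpha, beta] ->
      (mbar theta - y) ^+ 2 <= (mbar theta' - y) ^+ 2].

Definition psi (R : realType) (alpha beta : R) (m : R -> R) (theta0 : R)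
    (l : nat) : R :=
  derive1n l (inverse_moment alpha beta m) (m theta0) / l`!%:R.

Definition eta (R : realType) (m : R -> R) (theta0 : R) (n : nat) (y : R) : R :=
  Num.sqrt n%:R * (y - m theta0).

(* As a function of the value [y] of the empirical moment. *)
Definition Psi0 (R : realType) (alpha beta : R) (m : R -> R) (theta0 : R)
    (k n : nat) (y : R) : R :=
  \sum_(1 <= l < k.+1) psi alpha beta m theta0 l *
    eta m theta0 n y ^+ l * n%:R `^ (- (l%:R / 2)).

(* Main.v *)
Require Import Defs.
From HB Require Import structures.
From mathcomp Require Import all_boot all_order all_algebra.
From mathcomp Require finmap.
From mathcomp Require Import all_classical all_reals all_analysis.
From mathcomp Require Import measurable_realfun.
From mathcomp Require Import zify lra.
Import Order.TTheory GRing.Theory Num.Theory.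
Import numFieldNormedType.Exports.
Local Open Scope classical_set_scope.
Local Open Scope ring_scope.
Set Implicit Arguments.
Unset Strict Implicit.
Unset Printing Implicit Defensive.

(** Write [Y] for the deviation of the empirical moment from [m theta0].

    Deterministic part.  The limits at the endpoints extend [m] to a continuous
    injective function on [[alpha, beta]], and the estimator is a monotone,
    hence measurable, function of the empirical moment.  For an empirical moment
    close to [m theta0] it is the inverse function [G], and [Psi0] is the Taylor
    polynomial of [G] of degree [k] without its constant term: the two differ by
    [O(`|Y| ^ (k + 1))] ([mme_taylor]).  As [x ^ p] is Lipschitz on bounded sets
    for [1 < p], the [p]-th powers differ by as much.  Away from [m theta0] the
    estimator is bounded and [Psi0] is at most of degree [k] in [Y], so that
    [O(`|Y| ^ (2 N))] holds with any [N] such that [k p <= 2 N]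
    ([mme_powR_expansion]).

    Probabilistic part.  All that remains is
    [E (Y ^ (2 s)) = O(n ^ (- s))] ([total_deviation_moment]), which gives
    [E (`|Y| ^ (k + 1)) = O(n ^ (- (k + 1) / 2))]; this exponent is slightly better
    than the required [(2 k + 1) / 4].  When [g] is a step function on disjoint
    intervals, [n Y] is a linear combination of independent centred Poisson
    variables.  The Chen-Stein identity [E (N F(N)) = r E (F(N + 1))] yields a
    recursion for the moments of such a combination ([centred_moment_rec]), in
    which each factor [n] is paid for by at least two orders
    ([centred_moment_bound]).  The bound depends on the step function only
    through the integrals of its powers for the mean measure.

    A general [g] is approximated by step functions for the mean measure
    [lambda theta0 t dt], with control of the moments ([step_approximation]).
    Campbell's formula ([campbell]), obtained from the Poisson means of the counts
    by a Dynkin class argument, says that such an approximation is also an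
    approximation in mean of the integrals against the processes.  Convergence in
    mean of order one is enough to transfer the moment bounds, after truncation
    ([total_deviation_moment]). *)

(** * Independent Poisson counts *)

Lemma measurable_countable_range d (Omega : measurableType d) (K : countType)
    d' (T : measurableType d') (M : Omega -> K) (F : K -> T) :
  (forall k, measurable [set w | M w = k]) ->
  measurable_fun setT (fun w => F (M w)).
Proof.
move=> mM _ B mB; rewrite setTI.
have -> : (fun w => F (M w)) @^-1` B =
    \bigcup_(k : K) (if `[< B (F k) >] then [set w | M w = k] else set0).
  apply/seteqP; split=> [w /= Bw|w [k _]].
    by exists (M w) => //; rewrite asboolT.
  by case: asboolP => // Bk /= ->.
apply: countable_bigcupT_measurable; first exact: countableP.
by move=> k; case: ifP.
Qed.

(** The fibres of [M] partition the space.  They are indexed by [nat] through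
    [pickle_inv], so that two such integrals can be compared as series. *)
Lemma integral_countable_range d (Omega : measurableType d) (R : realType)
    (P : probability Omega R) (K : countType) (M : Omega -> K) (H : K -> R) :
  (forall k, measurable [set w | M w = k]) -> (forall k, 0 <= H k) ->
  (\int[P]_w (H (M w))%:E = \sum_(i <oo)
     if @pickle_inv K i is Some k then (H k)%:E * P [set w | M w = k] else 0)%E.
Proof.
move=> mM H0.
pose F i : set Omega :=
  if @pickle_inv K i is Some k then [set w | M w = k] else set0.
have mF i : measurable (F i) by rewrite /F; case: pickle_inv.
have FT : \bigcup_i F i = setT.
  apply/seteqP; split=> // w _; exists (pickle (M w)) => //=.
  by rewrite /F pickleK_inv.
rewrite -FT ge0_integral_bigcup//; first last.
- move=> i j _ _ [w []]; rewrite /F.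
  case Ei: pickle_inv => [ki|]//= Mi; case Ej: pickle_inv => [kj|]//= Mj.
  move: (@pickle_invK K i) (@pickle_invK K j); rewrite /ocancel Ei Ej /= => <- <-.
  by rewrite -Mi -Mj.
- by move=> w _; rewrite lee_fin.
- rewrite FT; apply/measurable_EFinP.
  exact: measurable_countable_range.
apply: eq_eseriesr => i _; have := mF i; rewrite /F.
case: pickle_inv => [k|] mk; last by rewrite integral_set0.
rewrite (eq_integral (cst (H k)%:E)) ?integral_cst//.
by move=> w; rewrite inE /= => ->.
Qed.

(** The weights are spelled out because at rate [0] they are those of the point
    mass at [0]. *)
Definition poisson_weight (R : realType) (r : R) (k : nat) : R :=
  expR (- r) * r ^+ k / k`!%:R.

(** Independent Poisson variables with rates [r a], given by their joint law. *)
Definition poisson_system d (Omega : measurableType d) (R : realType)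
    (P : probability Omega R) (A : finType) (r : A -> R)
    (N : Omega -> {ffun A -> nat}) : Prop :=
  (forall a, 0 <= r a) /\
  forall k, measurable [set w | N w = k] /\
    P [set w | N w = k] = (\prod_a poisson_weight (r a) (k a))%:E.

Definition incr (A : finType) (a : A) (k : {ffun A -> nat}) : {ffun A -> nat} :=
  [ffun b => (k b + (b == a))%N].

Lemma poisson_weightS (R : realType) (r : R) (k : nat) :
  k.+1%:R * poisson_weight r k.+1 = r * poisson_weight r k.
Proof.
rewrite /poisson_weight factS natrM invfM exprS.
have k0 : k.+1%:R != 0 :> R by rewrite pnatr_eq0.
transitivity (r * (expR (- r) * r ^+ k / k`!%:R) * (k.+1%:R * k.+1%:R^-1)).
  by set x := _.+1%:R; set y := r ^+ k; set z := k`!%:R^-1; set x' := x^-1; lra.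
by rewrite mulfV// mulr1.
Qed.

Section PoissonSystem.
Context d (Omega : measurableType d) (R : realType) (P : probability Omega R).
Context (A : finType) (r : A -> R) (N : Omega -> {ffun A -> nat}).
Hypothesis sysN : poisson_system P r N.

Lemma poisson_system_measurable d' (T : measurableType d')
    (F : {ffun A -> nat} -> T) : measurable_fun setT (fun w => F (N w)).
Proof.
by apply: measurable_countable_range => k; have [] := sysN.2 k.
Qed.

Lemma incrP (a : A) (k k' : {ffun A -> nat}) :
  incr a k' = k <-> (0 < k a)%N /\ k' = [ffun b => (k b - (b == a))%N].
Proof.
split=> [<-|[ka ->]]; last first.
  apply/ffunP => b; rewrite !ffunE; case: eqP => [->|_].
    by rewrite subnK.
  by rewrite subn0 addn0.
split; first by rewrite ffunE eqxx addn1.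
by apply/ffunP => b; rewrite !ffunE addnK.
Qed.

Lemma measurable_incr (a : A) k : measurable [set w | incr a (N w) = k].
Proof.
have [ka|ka] := boolP (0 < k a)%N; last first.
  rewrite (_ : [set _ | _] = set0)//.
  by apply/seteqP; split=> // w /incrP[]; rewrite (negbTE ka).
have := (sysN.2 [ffun b => (k b - (b == a))%N]).1.
rewrite (_ : [set w | incr a (N w) = k] =
             [set w | N w = [ffun b => (k b - (b == a))%N]])//.
by apply/seteqP; split=> w /=; [case/incrP|move=> ?; apply/incrP].
Qed.

Lemma probability_incr (a : A) (k : {ffun A -> nat}) :
  ((k a)%:R%:E * P [set w | N w = k] =
   (r a)%:E * P [set w | incr a (N w) = k])%E.
Proof.
have [ka|] := posnP (k a).
  rewrite ka mul0e (_ : [set _ | _] = set0) ?measure0 ?mule0//.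
  by apply/seteqP; split=> // w /incrP[]; rewrite ka.
move=> ka; pose k' := [ffun b => (k b - (b == a))%N].
have -> : [set w | incr a (N w) = k] = [set w | N w = k'].
  by apply/seteqP; split=> w /=; [case/incrP|move=> ?; apply/incrP].
rewrite (sysN.2 k).2 (sysN.2 k').2 -!EFinM; congr EFin.
rewrite (bigD1 a)//= [in RHS](bigD1 a)//= !mulrA; congr (_ * _); last first.
  by apply: eq_bigr => b ba; rewrite ffunE (negbTE ba) subn0.
have -> : k' a = (k a).-1 by rewrite ffunE eqxx subn1.
by have := poisson_weightS (r a) (k a).-1; rewrite /poisson_weight prednK// !mulrA.
Qed.

(** For a Poisson variable [k * P(N = k) = r * P(N + 1 = k)].  With the other
    variables fixed this is the Chen-Stein identity below; it holds for every
    function of the counts, in the extended reals, because both sides of it are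
    sums over the countable range of the counts. *)
Lemma poisson_stein_ge0 (a : A) (F : {ffun A -> nat} -> R) :
  (forall k, 0 <= F k) ->
  (\int[P]_w ((N w a)%:R * F (N w))%:E =
   (r a)%:E * \int[P]_w (F (incr a (N w)))%:E)%E.
Proof.
move=> F0.
rewrite (integral_countable_range _
  (H := fun k : {ffun A -> nat} => (k a)%:R * F k)); first last.
- by move=> k; rewrite mulr_ge0.
- by move=> k; case: (sysN.2 k).
rewrite (integral_countable_range _ (M := fun w => incr a (N w)))//; last first.
  exact: measurable_incr.
rewrite -nneseriesZl; last first.
  by move=> i _; case: pickle_inv => [k|]//; rewrite mule_ge0// lee_fin.
apply: eq_eseriesr => i _; case: pickle_inv => [k|]; last by rewrite mule0.
by rewrite muleCA -probability_incr EFinM -muleA muleCA.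
Qed.

Lemma poisson_integrable_incr (a : A) (F : {ffun A -> nat} -> R) :
  P.-integrable setT (fun w => (F (incr a (N w)))%:E) ->
  P.-integrable setT (fun w => ((N w a)%:R * F (N w))%:E).
Proof.
move=> /integrableP[_ Fi]; apply/integrableP; split.
  apply/measurable_EFinP.
  exact: (poisson_system_measurable (fun k => (k a)%:R * F k)).
under eq_integral do rewrite abse_EFin normrM normr_nat.
rewrite (poisson_stein_ge0 a (F := fun k => `|F k|))//.
by rewrite lte_mul_pinfty// lee_fin sysN.1.
Qed.

Lemma poisson_stein (a : A) (F : {ffun A -> nat} -> R) :
  P.-integrable setT (fun w => (F (incr a (N w)))%:E) ->
  (\int[P]_w ((N w a)%:R * F (N w))%:E =
   (r a)%:E * \int[P]_w (F (incr a (N w)))%:E)%E.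
Proof.
move=> Fi.
pose Fp k := Num.max (F k) 0; pose Fn k := Num.max (- F k) 0.
have Fp0 k : 0 <= Fp k by rewrite le_max lexx orbT.
have Fn0 k : 0 <= Fn k by rewrite le_max lexx orbT.
have Ep : (fun w => ((N w a)%:R * F (N w))%:E)^\+%E =
          (fun w => ((N w a)%:R * Fp (N w))%:E).
  by apply/funext => w; rewrite funeposE -EFin_max maxr_pMr// mulr0.
have En : (fun w => ((N w a)%:R * F (N w))%:E)^\-%E =
          (fun w => ((N w a)%:R * Fn (N w))%:E).
  by apply/funext => w; rewrite funenegE -EFinN -EFin_max -mulrN maxr_pMr// mulr0.
have Ip : (\int[P]_w (fun w => (F (incr a (N w)))%:E)^\+ w =
           \int[P]_w (Fp (incr a (N w)))%:E)%E.
  by apply: eq_integral => w _; rewrite funeposE /Fp EFin_max.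
have In : (\int[P]_w (fun w => (F (incr a (N w)))%:E)^\- w =
           \int[P]_w (Fn (incr a (N w)))%:E)%E.
  by apply: eq_integral => w _; rewrite funenegE /Fn EFin_max.
have fn : (\int[P]_w (Fn (incr a (N w)))%:E)%E \is a fin_num.
  by rewrite -In; exact: integrable_neg_fin_num Fi.
rewrite integralE [in RHS]integralE Ep En Ip In !poisson_stein_ge0//.
by rewrite [RHS]muleBr// fin_num_adde_defl// fin_numN.
Qed.

End PoissonSystem.

Section CentredPoissonSum.
Context d (Omega : measurableType d) (R : realType) (P : probability Omega R).

Lemma Rintegral_sum (I : Type) (s : seq I) (f : I -> Omega -> R) :
  (forall i, P.-integrable setT (fun w => (f i w)%:E)) ->
  \int[P]_w (\sum_(i <- s) f i w) = \sum_(i <- s) \int[P]_w f i w.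
Proof.
move=> fi; elim: s => [|i s ih].
  under eq_Rintegral do rewrite big_nil.
  by rewrite big_nil Rintegral_cst// mul0r.
under eq_Rintegral do rewrite big_cons.
rewrite RintegralD// ?ih ?big_cons//; first exact: fi.
rewrite (_ : _ \o _ = fun w => (\sum_(i <- s) (f i w)%:E)%E).
  exact: (@integrable_sum _ _ _ _ _ _ _ s xpredT (fun i w => (f i w)%:E)).
by apply/funext => w; rewrite /= sumEFin.
Qed.

Context (A : finType) (r : A -> R) (N : Omega -> {ffun A -> nat}).
Hypothesis sysN : poisson_system P r N.
Context (c : A -> R).

Definition centred_sum (k : {ffun A -> nat}) : R :=
  \sum_a c a * ((k a)%:R - r a).

Lemma centred_sum_incr a k : centred_sum (incr a k) = centred_sum k + c a.
Proof.
rewrite /centred_sum (bigD1 a)//= [in RHS](bigD1 a)//= ffunE eqxx natrD.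
rewrite mulr1n [RHS]addrAC; congr (_ + _); first lra.
by apply: eq_bigr => b ba; rewrite ffunE (negbTE ba) addn0.
Qed.

Lemma centred_sum_powS s k : centred_sum k ^+ s.+1 =
  \sum_a c a * ((k a)%:R * centred_sum k ^+ s) -
  (\sum_a c a * r a) * centred_sum k ^+ s.
Proof.
rewrite exprS {1}/centred_sum !mulr_suml -sumrB; apply: eq_bigr => a _.
by rewrite mulrBr mulrBl !mulrA.
Qed.

Lemma integrableXD (f : Omega -> R) (y : R) s :
  (forall t, (t <= s)%N -> P.-integrable setT (fun w => (f w ^+ t)%:E)) ->
  P.-integrable setT (fun w => ((f w + y) ^+ s)%:E).
Proof.
move=> fi.
rewrite (_ : (fun w => _) = fun w => (\sum_(i < s.+1)
   (y ^+ i *+ 'C(s, i))%:E * (f w ^+ (s - i))%:E)%E); last first.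
  apply/funext => w; rewrite exprDn -sumEFin; apply: eq_bigr => i _.
  by rewrite -EFinM mulrnAl mulrC.
apply: integrable_sum => // i _; apply: integrableZl => //.
by apply: fi; rewrite leq_subr.
Qed.

Lemma integrable_centred_sum s :
  P.-integrable setT (fun w => (centred_sum (N w) ^+ s)%:E).
Proof.
elim/ltn_ind: s => -[_|s ih].
  under eq_fun do rewrite expr0.
  exact: finite_measure_integrable_cst.
rewrite (_ : (fun w => _) = (fun w => \sum_a
      (c a)%:E * ((N w a)%:R * centred_sum (N w) ^+ s)%:E) \-
   fun w => (\sum_a c a * r a)%:E * (centred_sum (N w) ^+ s)%:E)%E; last first.
  apply/funext => w; rewrite centred_sum_powS EFinB -sumEFin.
  by congr (_ - _)%E; apply: eq_bigr => a _; rewrite EFinM.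
apply: integrableB => //; last by apply: integrableZl => //; exact: ih.
apply: integrable_sum => // a _; apply: integrableZl => //.
apply: (poisson_integrable_incr sysN (F := fun k => centred_sum k ^+ s)).
under eq_fun do rewrite centred_sum_incr.
exact: integrableXD.
Qed.

(** The Chen-Stein identity for [F = centred_sum ^+ s]: the terms of order
    [0] cancel, so that two orders are lost for each factor
    [\sum_a r a * c a ^+ q], with [2 <= q].  This is why the moment of order [s]
    of a sum over [n] processes grows like [n ^ (s / 2)] only. *)
Lemma centred_moment_rec s :
  \int[P]_w centred_sum (N w) ^+ s.+1 =
  \sum_(q < s) (\sum_a r a * c a ^+ q.+2) *+ 'C(s, q.+1) *
     \int[P]_w centred_sum (N w) ^+ (s - q.+1).
Proof.
have iS := integrable_centred_sum.
have iNS a : P.-integrable setT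
    (fun w => ((N w a)%:R * centred_sum (N w) ^+ s)%:E).
  apply: (poisson_integrable_incr sysN (F := fun k => centred_sum k ^+ s)).
  under eq_fun do rewrite centred_sum_incr.
  by apply: integrableXD.
have stein a : \int[P]_w ((N w a)%:R * centred_sum (N w) ^+ s) =
    r a * \sum_(q < s.+1) (c a ^+ q *+ 'C(s, q)) *
       \int[P]_w centred_sum (N w) ^+ (s - q).
  rewrite [LHS]/Rintegral (poisson_stein sysN (F := fun k => centred_sum k ^+ s));
    last first.
    under eq_fun do rewrite centred_sum_incr.
    by apply: integrableXD.
  under eq_integral do rewrite centred_sum_incr.
  rewrite fineM//; last first.
    by apply: integrable_fin_num => //; apply: integrableXD.
  congr (_ * _); rewrite -/(Rintegral _ _ _).
  rewrite (_ : (fun x => _) = fun w => \sum_(i < s.+1)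
     (c a ^+ i *+ 'C(s, i)) * centred_sum (N w) ^+ (s - i)); last first.
    apply/funext => w; rewrite exprDn; apply: eq_bigr => i _.
    by rewrite mulrnAl mulrC.
  rewrite Rintegral_sum; last first.
    by move=> i; under eq_fun do rewrite EFinM; exact: integrableZl.
  by apply: eq_bigr => i _; rewrite RintegralZl//; exact: iS.
under eq_Rintegral do rewrite centred_sum_powS.
rewrite RintegralB//; last 2 first.
- rewrite (_ : _ \o _ = fun w => (\sum_a
      (c a)%:E * ((N w a)%:R * centred_sum (N w) ^+ s)%:E)%E); last first.
    apply/funext => w; rewrite /= -sumEFin.
    by apply: eq_bigr => a _; rewrite EFinM.
  by apply: integrable_sum => // a _; apply: integrableZl.
- rewrite (_ : _ \o _ = fun w =>
      ((\sum_a c a * r a)%:E * (centred_sum (N w) ^+ s)%:E)%E)//.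
  exact: integrableZl.
rewrite [X in _ - X]RintegralZl//; last exact: iS.
rewrite (Rintegral_sum _
  (f := fun a w => c a * ((N w a)%:R * centred_sum (N w) ^+ s))); last first.
  by move=> a; under eq_fun do rewrite EFinM; exact: integrableZl.
have -> : \sum_a \int[P]_w (c a * ((N w a)%:R * centred_sum (N w) ^+ s)) =
    \sum_a \sum_(q < s.+1) (r a * c a ^+ q.+1) *+ 'C(s, q) *
       \int[P]_w centred_sum (N w) ^+ (s - q).
  apply: eq_bigr => a _.
  have -> : \int[P]_w (c a * ((N w a)%:R * centred_sum (N w) ^+ s)) =
      c a * \int[P]_w ((N w a)%:R * centred_sum (N w) ^+ s).
    by apply: RintegralZl => //; exact: iNS.
  rewrite stein mulrA mulr_sumr.
  apply: eq_bigr => q _; rewrite mulrA; congr (_ * _).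
  by rewrite mulrnAr; congr (_ *+ _); rewrite exprS mulrCA mulrA.
rewrite exchange_big/= big_ord_recl/= subn0 addrAC.
rewrite [X in X + _](_ : _ = 0) ?add0r; last first.
  rewrite mulr_suml -sumrB big1// => a _.
  by rewrite bin0 mulr1n expr1 [r a * _]mulrC subrr.
apply: eq_bigr => q _; rewrite -mulr_suml; congr (_ * _).
by rewrite sumrMnl.
Qed.

(** Each step of the recursion contributes a factor [n * B] and lowers the order
    by at least two, hence the exponent [s./2] of [n].  The factor [2 ^ (s ^ 2)]
    absorbs the sums of binomial coefficients. *)
Lemma centred_moment_bound (B : R) (n s : nat) :
  1 <= B -> (1 <= n)%N ->
  (forall q, (2 <= q <= s)%N -> `|\sum_a r a * c a ^+ q| <= n%:R * B) ->
  `|\int[P]_w centred_sum (N w) ^+ s| <= B ^+ s * 2 ^+ (s ^ 2) * n%:R ^+ s./2.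
Proof.
move=> B1 n1.
have B0 : 0 <= B by apply: le_trans B1.
have n1R : 1 <= n%:R :> R by rewrite ler1n.
elim/ltn_ind: s => -[_ _|s ih hB].
  under eq_Rintegral do rewrite expr0.
  by rewrite Rintegral_cst//= probability_setT mul1r !expr0 !mulr1 normr1.
rewrite centred_moment_rec (le_trans (ler_norm_sum _ _ _))//.
apply: (@le_trans _ _ (\sum_(q < s) 'C(s, q.+1)%:R *
    (B ^+ s.+1 * 2 ^+ (s ^ 2) * n%:R ^+ s.+1./2))).
  apply: ler_sum => q _; rewrite -mulr_natl !normrM normr_nat -mulrA.
  rewrite ler_wpM2l//.
  have sq : (s - q.+1 < s.+1)%N by rewrite ltnS leq_subr.
  have le2 := ih _ sq _.
  apply: (@le_trans _ _ ((n%:R * B) * (B ^+ (s - q.+1) * 2 ^+ ((s - q.+1) ^ 2)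
      * n%:R ^+ (s - q.+1)./2))).
    apply: ler_pM => //.
      by apply: hB; rewrite /= !ltnS.
    apply: le2 => t /andP[t2 ts]; apply: hB; rewrite t2 (leq_trans ts)//.
    exact: ltnW.
  have Bs : B * B ^+ (s - q.+1) <= B ^+ s.+1.
    by rewrite -exprS ler_weXn2l// ltnS leq_subr.
  have ns : n%:R * n%:R ^+ (s - q.+1)./2 <= n%:R ^+ s.+1./2 :> R.
    rewrite -exprS ler_weXn2l//.
    have : ((s - q.+1).+2 <= s.+1)%N by have := ltn_ord q; lia.
    by move=> /half_leq.
  have ts : 2 ^+ ((s - q.+1) ^ 2) <= 2 ^+ (s ^ 2) :> R.
    by rewrite ler_weXn2l ?ler1n// leq_exp2r// leq_subr.
  rewrite mulrCA !mulrA [X in X <= _](_ : _ = (B * B ^+ (s - q.+1)) *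
    2 ^+ ((s - q.+1) ^ 2) * (n%:R * n%:R ^+ (s - q.+1)./2)); last first.
    set b := _ ^+ (s - _); set b' := _ ^+ (_ ^ 2); set b'' := _ ^+ _./2; lra.
  apply: ler_pM => //; rewrite ?mulr_ge0 ?exprn_ge0//.
  by apply: ler_pM => //; rewrite ?mulr_ge0 ?exprn_ge0.
rewrite -mulr_suml !mulrA ler_wpM2r ?exprn_ge0// -mulrA mulrCA ler_wpM2l ?exprn_ge0//.
apply: (@le_trans _ _ (2 ^+ s * 2 ^+ (s ^ 2))).
  rewrite ler_wpM2r ?exprn_ge0// -natr_sum -natrX ler_nat.
  have -> : (2 ^ s = \sum_(i < s.+1) 'C(s, i))%N.
    by rewrite (Pascal 1 1); apply: eq_bigr => i _; rewrite !exp1n !muln1.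
  by rewrite big_ord_recl/= leq_addl.
rewrite -exprD ler_weXn2l ?ler1n//.
by rewrite -!mulnn mulSn mulnS; lia.
Qed.

End CentredPoissonSum.

(** * Counts of a Poisson process *)

Lemma sigma_algebra_bigcap_fin (T : Type) (G : set (set T)) (l : nat)
    (E : 'I_l -> set T) :
  sigma_algebra setT G -> (forall i, G (E i)) ->
  G (\bigcap_(i in [set: 'I_l]) E i).
Proof.
move=> sG GE; pose E' m : set T := if insub m is Some i then E i else setT.
have -> : \bigcap_(i in [set: 'I_l]) E i = \bigcap_m E' m.
  apply/seteqP; split=> t Et i _; last by have := Et i I; rewrite /E' valK.
  by rewrite /E'; case: insubP => [j _ _|//]; exact: Et.
rewrite -[X in G X]setCK setC_bigcap -setTD.
case: sG => G0 GC GU; apply: (GC); apply: GU => m.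
rewrite -setTD; apply: (GC); rewrite /E'; case: insubP => [i _ _|_]; first exact: GE.
by rewrite -setC0 -setTD; exact: GC.
Qed.

Section PoissonProcesses.
Context d (Omega : measurableType d) (R : realType) (P : probability Omega R).
Context (T : interval R) (f : R -> R) (n : nat).
Context (X : 'I_n -> Omega -> {measure set (measurableTypeR R) -> \bar R}).
Hypothesis iidX : iid_poisson_processes P T f X.

Definition counts (l : nat) (J : 'I_l -> interval R) (w : Omega) :
    {ffun 'I_n * 'I_l -> nat} :=
  [ffun a => Num.truncn (fine (X a.1 w [set` J a.2]))].

Lemma countsE (l : nat) (J : 'I_l -> interval R) w j i :
  (forall i, subintervals T (J i)) ->
  X j w [set` J i] = (counts J w (j, i))%:R%:E.
Proof.
move=> TJ; rewrite ffunE /=.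
have [+ _ _ _] := iidX.1 j; move=> /(_ w (J i) (TJ i))[k ->] /=.
by rewrite Num.Theory.natrK.
Qed.

(** Fixing all the counts is an intersection of one event per process, to which
    the independence of the processes applies; inside a process the counts on
    disjoint intervals are independent. *)
Lemma poisson_system_counts (l : nat) (J : 'I_l -> interval R) :
  (forall i, subintervals T (J i)) ->
  trivIset setT (fun i => [set` J i]) ->
  (forall t, t \in T -> 0 <= f t) ->
  poisson_system P
    (fun a => \int[lebesgue_measure]_(t in [set` J a.2]) f t) (counts J).
Proof.
move=> TJ dJ f0; split=> [[j i]|k] /=.
  apply: Rintegral_ge0 => t Jt; apply: f0.
  by have [a [b [Jab abT]]] := TJ i; exact/abT/Jab.
pose E j i := [set w | X j w [set` J i] = (k (j, i))%:R%:E].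
have kE : [set w | counts J w = k] =
    \bigcap_(j in [set: 'I_n]) \bigcap_(i in [set: 'I_l]) E j i.
  apply/seteqP; split=> w /=.
    by move=> wk j _ i _; rewrite /E /= -wk countsE.
  move=> Ew; apply/ffunP => -[j i].
  have := Ew j I i I; rewrite /E /= countsE// => -[] /eqP.
  by rewrite eqr_nat => /eqP.
have mE j i : measurable (E j i).
  have [_ mX _ _] := iidX.1 j; have := mX _ (TJ i) measurableT.
  move=> /(_ [set (k (j, i))%:R%:E] (emeasurable_set1 _)); rewrite setTI.
  by congr measurable.
split.
  rewrite kE; apply: fin_bigcap_measurable => // j _.
  exact: fin_bigcap_measurable.
rewrite kE (iidX.2 (fun j => \bigcap_(i in [set: 'I_l]) E j i)); last first.
  move=> j; apply: sigma_algebra_bigcap_fin => [|i].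
    exact: smallest_sigma_algebra.
  by apply: sub_sigma_algebra; exists (J i), (k (j, i)).
rewrite (eq_bigr (fun j => (\prod_(i < l)
    poisson_weight (\int[lebesgue_measure]_(t in [set` J i]) f t)
      (k (j, i)))%:E)) => [|j _].
  rewrite prodEFin pair_bigA/=; congr EFin.
  by apply: eq_bigr => -[].
have [_ _ PX indX] := iidX.1 j.
rewrite (indX _ J)// => [|i].
  by rewrite -prodEFin; apply: eq_bigr => i _; rewrite PX.
by apply: sub_sigma_algebra; exists (J i), (k (j, i)).
Qed.

End PoissonProcesses.

(** * Mean measure of a Poisson process *)

Lemma itv_bound_exhaustion_l (R : realType) (l : itv_bound R) : l != +oo%O ->
  exists a : nat -> R, [/\ (forall i j, (i <= j)%N -> a j <= a i),
    (forall m x, a m <= x -> (l <= BLeft x)%O) &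
    (forall x, (l <= BLeft x)%O -> exists m, a m <= x)].
Proof.
case: l => [[] x _|[]// _].
- exists (fun=> x); split=> // y; rewrite bnd_simp => xy.
  by exists 0%N.
- exists (fun m => x + m.+1%:R^-1); split=> [i j ij|m y|y].
  + by rewrite lerD2l lef_pV2 ?posrE// ler_nat ltnS.
  + by rewrite bnd_simp; apply: lt_le_trans; rewrite ltrDl invr_gt0.
  + rewrite bnd_simp => xy; exists (Num.truncn (y - x)^-1).
    rewrite -lerBrDl invf_ple ?posrE ?subr_gt0//.
    have h : 0 < (y - x)^-1 by rewrite invr_gt0 subr_gt0.
    by have /andP[_ /ltW] := truncn_itv (ltW h).
- exists (fun m => - m%:R); split=> // [i j ij|x _].
    by rewrite lerN2 ler_nat.
  exists (Num.truncn `|x|).+1; rewrite lerNl.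
  have /andP[_ /ltW] := truncn_itv (normr_ge0 x); apply: le_trans.
  by rewrite -normrN ler_norm.
Qed.

Lemma itv_bound_exhaustion_r (R : realType) (l : itv_bound R) : l != -oo%O ->
  exists a : nat -> R, [/\ (forall i j, (i <= j)%N -> a i <= a j),
    (forall m x, x <= a m -> (BRight x <= l)%O) &
    (forall x, (BRight x <= l)%O -> exists m, x <= a m)].
Proof.
case: l => [[] x _|[]// _].
- exists (fun m => x - m.+1%:R^-1); split=> [i j ij|m y|y].
  + by rewrite lerD2l lerN2 lef_pV2 ?posrE// ler_nat ltnS.
  + by rewrite bnd_simp => /le_lt_trans; apply; rewrite ltrBlDr ltrDl invr_gt0.
  + rewrite bnd_simp => xy; exists (Num.truncn (x - y)^-1).
    rewrite lerBrDr -lerBrDl invf_ple ?posrE ?subr_gt0//.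
    have h : 0 < (x - y)^-1 by rewrite invr_gt0 subr_gt0.
    by have /andP[_ /ltW] := truncn_itv (ltW h).
- exists (fun=> x); split=> // y; rewrite bnd_simp => xy.
  by exists 0%N.
- exists (fun m => m%:R); split=> // [i j ij|x _].
    by rewrite ler_nat.
  exists (Num.truncn `|x|).+1.
  have /andP[_ /ltW] := truncn_itv (normr_ge0 x); apply: le_trans.
  by rewrite ler_norm.
Qed.

(** Counts are finite on compact subintervals only: what is proved there reaches
    [T] along such an increasing sequence. *)
Lemma itv_exhaustion (R : realType) (T : interval R) : exists a b : nat -> R,
  [/\ (forall m, `[a m, b m] `<=` [set` T]),
    (forall i j, (i <= j)%N -> `[a i, b i] `<=` `[a j, b j]) &
    \bigcup_m `[a m, b m]%classic = [set` T]].
Proof.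
case: T => l r.
have empty : [set` Interval l r] = set0 -> exists a b : nat -> R,
  [/\ (forall m, `[a m, b m] `<=` [set` Interval l r]),
    (forall i j, (i <= j)%N -> `[a i, b i] `<=` `[a j, b j]) &
    \bigcup_m `[a m, b m]%classic = [set` Interval l r]].
  move=> ->; exists (fun=> 1), (fun=> 0).
  have e : `[1, 0]%classic = set0 :> set R by rewrite set_itv_ge// bnd_simp ler10.
  by split=> [m|i j _|]; rewrite ?e ?bigcup0.
have [lE|loo] := eqVneq l +oo%O.
  by apply: empty; rewrite lE; apply/seteqP; split=> // x; rewrite /= itv_boundlr.
have [rE|roo] := eqVneq r -oo%O.
  by apply: empty; rewrite rE; apply/seteqP; split=> // x; rewrite /= itv_boundlr andbF.
have [a [a1 a2 a3]] := itv_bound_exhaustion_l loo.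
have [b [b1 b2 b3]] := itv_bound_exhaustion_r roo.
have abT m : `[a m, b m] `<=` [set` Interval l r].
  by move=> x; rewrite /= in_itv/= itv_boundlr => /andP[/a2-> /b2->].
have abM i j : (i <= j)%N -> `[a i, b i] `<=` `[a j, b j].
  move=> ij x; rewrite /= !in_itv/= => /andP[/(le_trans (a1 _ _ ij))->/=].
  by move=> /le_trans; apply; exact: b1.
exists a, b; split=> //; apply/seteqP; split=> [x [m _]|x]; first exact: abT.
rewrite /= itv_boundlr => /andP[/a3[i ai] /b3[j bj]].
exists (maxn i j) => //=; rewrite in_itv/=; apply/andP; split.
  by apply: le_trans ai; apply/a1/leq_maxl.
by apply: (le_trans bj); apply/b1/leq_maxr.
Qed.

Section MeanMeasure.
Context d (Omega : measurableType d) (R : realType) (P : probability Omega R).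
Context (T : interval R) (f : R -> R).
Context (X : Omega -> {measure set (measurableTypeR R) -> \bar R}).
Hypothesis intf : intensity T f.
Hypothesis poisX : poisson_process P T f X.
Let mu := @lebesgue_measure R.

Let mf : measurable_fun [set` T] (EFin \o f).
Proof. by apply/measurable_EFinP; case: intf. Qed.

Let f0 t : [set` T] t -> (0 <= (f t)%:E)%E.
Proof. by case: intf => _ f0 _ /f0; rewrite lee_fin. Qed.

(** The mean of a Poisson variable is the case [F = 1] of [poisson_stein_ge0]. *)
Lemma poisson_mean J : subintervals T J ->
  (\int[P]_w X w [set` J] = \int[mu]_(t in [set` J]) (f t)%:E)%E.
Proof.
move=> TJ; have [XN mX PX _] := poisX.
have JT : [set` J] `<=` [set` T].
  by have [a [b [Jab abT]]] := TJ; exact: subset_trans Jab abT.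
pose r := \int[mu]_(t in [set` J]) f t.
pose N w : {ffun unit -> nat} := [ffun=> Num.truncn (fine (X w [set` J]))].
have XE w : X w [set` J] = (N w tt)%:R%:E.
  by have [k Xk] := XN w J TJ; rewrite /N ffunE Xk/= Num.Theory.natrK.
have sysN : poisson_system P (fun=> r) N.
  split=> [_|k].
    by apply: Rintegral_ge0 => t /JT /f0; rewrite lee_fin.
  have -> : [set w | N w = k] = [set w | X w [set` J] = (k tt)%:R%:E].
    apply/seteqP; split=> w /=; first by rewrite XE => ->.
    rewrite XE => -[] /eqP; rewrite eqr_nat => /eqP Nk.
    by apply/ffunP => -[].
  split; last by rewrite PX// (bigD1 tt)//= big1 ?mulr1// => -[].
  have := mX _ TJ measurableT.
  move=> /(_ [set (k tt)%:R%:E] (emeasurable_set1 _)); rewrite setTI.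
  by congr measurable.
have := poisson_stein_ge0 sysN tt (F := fun=> 1) (fun=> ler01).
under eq_integral do rewrite mulr1 -XE.
have -> : (\int[P]__ 1 = 1)%E.
  by rewrite (integral_cst P measurableT 1) mul1e; exact: probability_setT.
move=> ->; rewrite mule1 fineK//.
rewrite ge0_fin_numE; first by case: intf => _ _; apply.
by apply: integral_ge0 => t /JT /f0.
Qed.

Let mean_spec B := measurable_fun setT (fun w => X w B) /\
  (\int[P]_w X w B = \int[mu]_(t in B) (f t)%:E)%E.

(** A Dynkin class argument from half-open intervals.  The compact interval makes
    the counts and the integral of [f] finite, so that the statement passes to
    complements by subtraction. *)
Lemma mean_spec_compact (a b : R) (B : set R) :
  `[a, b] `<=` [set` T] -> measurable B -> mean_spec (B `&` `[a, b]).
Proof.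
move=> abT mB.
pose G B := measurable B /\ mean_spec (B `&` `[a, b]).
suff : <<d @ocitv R >> `<=` G.
  by rewrite setI_closed_g_dynkin_g_sigma_algebra; [move=> /(_ B mB)[]|exact: ocitvI].
have mab : measurable `[a, b]%classic by exact: measurable_itv.
have sub J : [set` J] `<=` `[a, b] -> subintervals T J by exists a, b.
have subab : subintervals T `[a, b] by exact: sub.
have mX J : subintervals T J -> measurable_fun setT (fun w => X w [set` J]).
  by move=> TJ; have [_ + _ _] := poisX; apply.
have fab : (\int[mu]_(t in `[a, b]) (f t)%:E < +oo)%E.
  by case: intf => _ _; apply; exact: sub.
have mfS (A : set R) : measurable A -> A `<=` `[a, b] ->
    measurable_fun A (EFin \o f).
  by move=> mA Aab; apply: measurable_funS mf => //; exact: subset_trans Aab abT.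
have fS0 (A : set R) t : A `<=` `[a, b] -> A t -> (0 <= (f t)%:E)%E.
  by move=> Aab /Aab /abT /f0.
apply: smallest_sub.
  split; rewrite /G.
  - split; first exact: measurableT.
    rewrite setTI; split; first exact: (mX _ subab).
    exact: (poisson_mean subab).
  - move=> A [mA [mXA EXA]]; split; first exact: measurableC.
    have AU : `[a, b]%classic = (A `&` `[a, b]) `|` (~` A `&` `[a, b]).
      by rewrite -setIUl setUv setTI.
    have dA : [disjoint A `&` `[a, b] & ~` A `&` `[a, b]].
      by apply/eqP; rewrite setIACA setICr set0I.
    have XU w : X w `[a, b]%classic =
        (X w (A `&` `[a, b]) + X w (~` A `&` `[a, b]))%E.
      rewrite {1}AU measureU//; [exact: measurableI| |exact/eqP].
      by apply: measurableI => //; exact: measurableC.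
    have Xfin w : (X w (A `&` `[a, b])) \is a fin_num.
      rewrite ge0_fin_numE//; apply: (@le_lt_trans _ _ (X w `[a, b]%classic)).
        by rewrite le_measure ?inE//; exact: measurableI.
      have [+ _ _ _] := poisX; move=> /(_ w _ subab)[k ->].
      exact: ltry.
    have XD : (fun w => X w (~` A `&` `[a, b])) =
        (fun w => X w `[a, b]%classic - X w (A `&` `[a, b]))%E.
      by apply/funext => w; rewrite XU addeAC subee// add0e.
    have mXD : measurable_fun setT (fun w => X w (~` A `&` `[a, b])).
      by rewrite XD; apply: emeasurable_funB => //; exact: (mX _ subab).
    split=> //.
    have := poisson_mean subab.
    under eq_integral do rewrite XU.
    have -> : (\int[mu]_(t in `[a, b]) (f t)%:E =
        \int[mu]_(t in A `&` `[a, b]) (f t)%:E +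
        \int[mu]_(t in ~` A `&` `[a, b]) (f t)%:E)%E.
      rewrite [in LHS]AU ge0_integral_setU//.
      + exact: measurableI.
      + by apply: measurableI => //; exact: measurableC.
      + by rewrite -AU; exact: mfS.
      + by rewrite -AU => t; exact: fS0.
    rewrite ge0_integralD// EXA.
    have fin : (\int[mu]_(t in A `&` `[a, b]) (f t)%:E)%E \is a fin_num.
      rewrite ge0_fin_numE; last first.
        by apply: integral_ge0 => t; apply: fS0 => s [].
      apply: le_lt_trans fab; apply: ge0_subset_integral => //.
      + exact: measurableI.
      + exact: mfS.
      + by move=> t; exact: fS0.
    move=> /(congr1 (fun z => z - \int[mu]_(t in A `&` `[a, b]) (f t)%:E)%E).
    by rewrite addeAC subee// add0e addeAC subee// add0e.
  - move=> F dF GF; have mF k : measurable (F k) by case: (GF k).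
    split; first exact: bigcupT_measurable.
    have dFab : trivIset setT (fun k => F k `&` `[a, b]).
      by under eq_fun do rewrite setIC; exact: trivIset_setIl.
    have mFab k : measurable (F k `&` `[a, b]) by exact: measurableI.
    have XU : (fun w => X w (\bigcup_k F k `&` `[a, b])) =
        (fun w => \sum_(k <oo) X w (F k `&` `[a, b]))%E.
      apply/funext => w; rewrite setI_bigcupl.
      apply: measure_semi_bigcup => //; exact: bigcupT_measurable.
    split.
      rewrite XU; apply: ge0_emeasurable_sum => // k _.
      by have [_ []] := GF k.
    rewrite XU integral_nneseries//; last by move=> k; have [_ []] := GF k.
    rewrite setI_bigcupl ge0_integral_bigcup//.
    + by apply: eq_eseriesr => k _; have [_ []] := GF k.
    + by apply: mfS; [exact: bigcupT_measurable|move=> t [k _ []]].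
    + by move=> t [k _ [_ /abT /f0]].
move=> _ [[x y] _ <-]; split; first exact: measurable_itv.
rewrite -set_itvI.
have s := sub (`]x, y] `&` `[a, b])%O.
split; first by apply/mX/s; rewrite set_itvI.
by apply/poisson_mean/s; rewrite set_itvI.
Qed.

(** Sum [mean_spec_compact] over the increments of an exhaustion of [T]. *)
Lemma mean_measure (B : set R) : measurable B -> mean_spec (B `&` [set` T]).
Proof.
move=> mB; have [a [b [abT abM abU]]] := itv_exhaustion T.
pose K m : set R := `[a m, b m]%classic.
have mD m : measurable (seqDU K m).
  apply: measurableD; first exact: measurable_itv.
  by apply: bigsetU_measurable => i _; exact: measurable_itv.
have BDE m : B `&` seqDU K m = (B `&` seqDU K m) `&` `[a m, b m].
  by apply/seteqP; split=> [t [Bt Kt]|t []//]; split=> //; exact: subset_seqDU Kt.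
have spec m : mean_spec (B `&` seqDU K m).
  by rewrite BDE; apply: mean_spec_compact => //; exact: measurableI.
have -> : B `&` [set` T] = \bigcup_m (B `&` seqDU K m).
  by rewrite -setI_bigcupr -seqDU_bigcup_eq abU.
have dB : trivIset setT (fun m => B `&` seqDU K m).
  exact/trivIset_setIl/trivIset_seqDU.
have mBD m : measurable (B `&` seqDU K m) by exact: measurableI.
have XU : (fun w => X w (\bigcup_m (B `&` seqDU K m))) =
    (fun w => \sum_(m <oo) X w (B `&` seqDU K m))%E.
  apply/funext => w; apply: measure_semi_bigcup => //.
  exact: bigcupT_measurable.
have BT : \bigcup_m (B `&` seqDU K m) `<=` [set` T].
  by move=> t [m _ [_ Dt]]; apply: (abT m); exact: subset_seqDU Dt.
split.
  rewrite XU; apply: ge0_emeasurable_sum => // k _.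
  by have [] := spec k.
rewrite XU integral_nneseries//; last by move=> m; have [] := spec m.
rewrite ge0_integral_bigcup//.
- by apply: eq_eseriesr => m _; have [_ ->] := spec m.
- by apply: measurable_funS mf => //; exact: measurable_itv.
- by move=> t /BT /f0.
Qed.

End MeanMeasure.

Section Campbell.
Context d (Omega : measurableType d) (R : realType) (P : probability Omega R).
Context (T : interval R) (f : R -> R).
Context (X : Omega -> {measure set (measurableTypeR R) -> \bar R}).
Hypothesis intf : intensity T f.
Hypothesis poisX : poisson_process P T f X.
Let mu := @lebesgue_measure R.
Import HBNNSimple finmap.

Let mT : measurable [set` T]. Proof. exact: measurable_itv. Qed.

(** The mean of the random measure [X] on [T] has density [f]. *)
Definition campbell_spec (h : measurableTypeR R -> \bar R) : Prop :=
  measurable_fun setT (fun w => \int[X w]_(t in [set` T]) h t)%E /\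
  (\int[P]_w \int[X w]_(t in [set` T]) h t =
   \int[mu]_(t in [set` T]) (h t * (f t)%:E))%E.

Lemma campbell_nnsfun (h : {nnsfun measurableTypeR R >-> R}) :
  campbell_spec (EFin \o h).
Proof.
have [n [c [B [mB hE c0]]]] : exists n (c : 'I_n -> R) (B : 'I_n -> set R),
   [/\ forall i, measurable (B i), forall t, h t = \sum_(i < n) c i * \1_(B i) t
     & forall i, 0 <= c i].
  pose s := enum_fset (fset_set (range h)).
  exists (size s), (fun i => s`_i), (fun i => h @^-1` [set s`_i]); split.
  - by move=> i; exact: (measurable_funPTI h (measurable_set1 _)).
  - by move=> t; rewrite [LHS]fimfunEord.
  - move=> i; have : s`_i \in fset_set (range h) by exact: mem_nth.
    by rewrite in_fset_set// => /set_mem[t _ <-].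
have HX w : (\int[X w]_(t in [set` T]) (h t)%:E =
    \sum_(i < n) (c i)%:E * X w (B i `&` [set` T]))%E.
  under eq_integral do rewrite hE -sumEFin.
  rewrite ge0_integral_sum//.
  - apply: eq_bigr => i _; under eq_integral do rewrite EFinM.
    rewrite ge0_integralZl_EFin//.
      by rewrite integral_indic//; exact: mB.
    by apply/measurable_EFinP; apply: measurable_indic; exact: mB.
  - move=> i; apply/measurable_EFinP/measurable_funM => //.
    by apply: measurable_indic; exact: mB.
  - by move=> i t _; rewrite lee_fin mulr_ge0.
split.
  rewrite (_ : (fun w => _) = fun w =>
    (\sum_(i < n) (c i)%:E * X w (B i `&` [set` T]))%E); last exact/funext.
  apply: emeasurable_sum => i; apply: measurable_funeM.
  exact: (mean_measure intf poisX (mB i)).1.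
under eq_integral do rewrite HX.
have mf : measurable_fun [set` T] (EFin \o f).
  by apply/measurable_EFinP; case: intf.
have f0 t : [set` T] t -> 0 <= f t by case: intf => _ + _; apply.
rewrite ge0_integral_sum//; first last.
- by move=> i w _; rewrite mule_ge0// lee_fin.
- by move=> i; apply: measurable_funeM; exact: (mean_measure intf poisX (mB i)).1.
transitivity (\int[mu]_(t in [set` T])
    \sum_(i < n) (c i)%:E * ((\1_(B i) t)%:E * (f t)%:E))%E; last first.
  apply: eq_integral => t _; rewrite /= hE -EFinM mulr_suml -sumEFin.
  by apply: eq_bigr => i _; rewrite -!EFinM mulrA.
have mIf i : measurable_fun [set` T] (fun t => (\1_(B i) t)%:E * (f t)%:E)%E.
  apply: emeasurable_funM => //; apply/measurable_EFinP.
  exact: measurable_indic.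
rewrite ge0_integral_sum//.
- apply: eq_bigr => i _; rewrite !ge0_integralZl_EFin//.
  + congr (_ * _)%E; rewrite (mean_measure intf poisX (mB i)).2 setIC.
    rewrite [LHS]integral_mkcondr; apply: eq_integral => t _.
    by rewrite patchE indicE; case: (t \in B i); rewrite ?mul1e ?mul0e.
  + by move=> t Tt; rewrite mule_ge0 ?lee_fin// f0.
  + exact: mIf.
  + exact: (mean_measure intf poisX (mB i)).1.
- by move=> i; apply: measurable_funeM; exact: mIf.
- by move=> i t Tt; rewrite !mule_ge0 ?lee_fin// f0.
Qed.

(** Campbell's formula, by monotone approximation from sets. *)
Lemma campbell (h : measurableTypeR R -> \bar R) :
  (forall t, (0 <= h t)%E) -> measurable_fun setT h -> campbell_spec h.
Proof.
move=> h0 mh.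
pose h_ := nnsfun_approx measurableT mh.
have h_nd t : {homo (fun n => (h_ n t)%:E) : i j / (i <= j)%N >-> (i <= j)%E}.
  by move=> i j ij; rewrite lee_fin; exact/lefP/nd_nnsfun_approx.
have h_cvg t : (h_ n t)%:E @[n --> \oo] --> h t by exact: cvg_nnsfun_approx.
have f0 t : [set` T] t -> (0 <= (f t)%:E)%E.
  by case: intf => _ + _; rewrite lee_fin; apply.
have mh_ n : measurable_fun [set` T] (EFin \o h_ n).
  by apply/measurable_EFinP; exact: (measurable_funTS (measurable_funPT (h_ n))).
have Xcvg w : (\int[X w]_(t in [set` T]) (h_ n t)%:E)%E @[n --> \oo] -->
    (\int[X w]_(t in [set` T]) h t)%E.
  rewrite (eq_integral (fun t => limn (fun n => (h_ n t)%:E))); last first.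
    by move=> t _; apply/esym/cvg_lim => //; exact: h_cvg.
  apply: cvg_monotone_convergence => //.
  by move=> n t _; rewrite lee_fin.
have mX : measurable_fun setT (fun w => \int[X w]_(t in [set` T]) h t)%E.
  apply: (emeasurable_fun_cvg (fun n w => \int[X w]_(t in [set` T]) (h_ n t)%:E)%E).
    by move=> n; exact: (campbell_nnsfun (h_ n)).1.
  by move=> w _; exact: Xcvg.
split=> //.
have Pcvg : (\int[P]_w \int[X w]_(t in [set` T]) (h_ n t)%:E)%E @[n --> \oo] -->
    (\int[P]_w \int[X w]_(t in [set` T]) h t)%E.
  rewrite (eq_integral
    (fun w => limn (fun n => \int[X w]_(t in [set` T]) (h_ n t)%:E)))%E; last first.
    by move=> w _; apply/esym/cvg_lim => //; exact: Xcvg.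
  apply: cvg_monotone_convergence => //.
  - by move=> n; exact: (campbell_nnsfun (h_ n)).1.
  - by move=> n w _; apply: integral_ge0 => t _; rewrite lee_fin.
  - move=> w _ i j ij; apply: ge0_le_integral => //.
    + by move=> t _; rewrite lee_fin.
    + exact: mh_.
    + exact: mh_.
    + by move=> t _; exact: h_nd.
have mf : measurable_fun [set` T] (EFin \o f).
  by apply/measurable_EFinP; case: intf.
have mucvg : (\int[mu]_(t in [set` T]) ((h_ n t)%:E * (f t)%:E))%E @[n --> \oo] -->
    (\int[mu]_(t in [set` T]) (h t * (f t)%:E))%E.
  rewrite (eq_integral (fun t => limn (fun n => (h_ n t)%:E * (f t)%:E)))%E; last first.
    move=> t _; apply/esym/cvg_lim => //.
    by apply: cvgeZr => //; exact: h_cvg.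
  apply: cvg_monotone_convergence => //.
  - by move=> n; apply: emeasurable_funM; [exact: mh_|exact: mf].
  - by move=> n t Tt; rewrite mule_ge0 ?f0// lee_fin.
  - by move=> t Tt i j ij; rewrite lee_wpmul2r ?f0//; exact: h_nd.
rewrite -(cvg_lim _ mucvg)// -(cvg_lim _ Pcvg)//.
by congr (limn _); apply/funext => n; exact: (campbell_nnsfun (h_ n)).2.
Qed.

End Campbell.

(** * Approximation by step functions *)

Section WeightedIntegral.
Context (R : realType) (T : interval R) (f : R -> R).
Hypothesis intf : intensity T f.
Let mu := @lebesgue_measure R.

(** The integral of [h] for the mean measure [f(t) dt]. *)
Definition weighted_integral (h : R -> R) : \bar R :=
  (\int[mu]_(t in [set` T]) (h t * f t)%:E)%E.

Arguments weighted_integral h%_ring_scope.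

Let mT : measurable [set` T]. Proof. exact: measurable_itv. Qed.

Let mf : measurable_fun [set` T] f. Proof. by case: intf. Qed.

Let f0 t : [set` T] t -> 0 <= f t. Proof. by case: intf => _ + _; apply. Qed.

Lemma measurable_weighted (h : R -> R) : measurable_fun [set` T] h ->
  measurable_fun [set` T] (fun t => (h t * f t)%:E).
Proof. by move=> mh; apply/measurable_EFinP/measurable_funM. Qed.

Lemma weighted_integral_ge0 (h : R -> R) : (forall t, [set` T] t -> 0 <= h t) ->
  (0 <= weighted_integral h)%E.
Proof.
by move=> h0; apply: integral_ge0 => t Tt; rewrite lee_fin mulr_ge0 ?f0 ?h0.
Qed.

Lemma le_weighted_integral (h1 h2 : R -> R) :
  measurable_fun [set` T] h1 -> measurable_fun [set` T] h2 ->
  (forall t, [set` T] t -> 0 <= h1 t <= h2 t) ->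
  (weighted_integral h1 <= weighted_integral h2)%E.
Proof.
move=> m1 m2 h12; apply: ge0_le_integral => //.
- by move=> t Tt; rewrite lee_fin mulr_ge0 ?f0//; case/andP: (h12 t Tt).
- exact: measurable_weighted.
- exact: measurable_weighted.
- by move=> t Tt; rewrite lee_fin ler_wpM2r ?f0//; case/andP: (h12 t Tt).
Qed.

Lemma weighted_integralD (h1 h2 : R -> R) :
  measurable_fun [set` T] h1 -> measurable_fun [set` T] h2 ->
  (forall t, [set` T] t -> 0 <= h1 t) -> (forall t, [set` T] t -> 0 <= h2 t) ->
  weighted_integral (fun t => h1 t + h2 t) =
  (weighted_integral h1 + weighted_integral h2)%E.
Proof.
move=> m1 m2 h10 h20; rewrite /weighted_integral.
under eq_integral do rewrite mulrDl EFinD.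
apply: ge0_integralD => //.
- by move=> t Tt; rewrite lee_fin mulr_ge0 ?f0 ?h10.
- exact: measurable_weighted.
- by move=> t Tt; rewrite lee_fin mulr_ge0 ?f0 ?h20.
- exact: measurable_weighted.
Qed.

Lemma weighted_integralZ (k : R) (h : R -> R) : 0 <= k ->
  measurable_fun [set` T] h -> (forall t, [set` T] t -> 0 <= h t) ->
  weighted_integral (fun t => k * h t) = (k%:E * weighted_integral h)%E.
Proof.
move=> k0 mh h0; rewrite /weighted_integral.
under eq_integral do rewrite -mulrA EFinM.
apply: ge0_integralZl_EFin => //.
- by move=> t Tt; rewrite lee_fin mulr_ge0 ?f0 ?h0.
- exact: measurable_weighted.
Qed.

(** Dominated convergence. *)
Lemma weighted_integral_small (h_ : nat -> R -> R) (G : R -> R) (eps : R) :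
  (forall n, measurable_fun [set` T] (h_ n)) -> measurable_fun [set` T] G ->
  (forall n t, [set` T] t -> 0 <= h_ n t <= G t) ->
  (weighted_integral G < +oo)%E ->
  (forall t, [set` T] t -> h_ n t @[n --> \oo] --> 0) -> 0 < eps ->
  exists n, (weighted_integral (h_ n) <= eps%:E)%E.
Proof.
move=> mh mG hG Gfin hcvg eps0.
have G0 t : [set` T] t -> 0 <= G t.
  by move=> Tt; case/andP: (hG 0%N t Tt) => /le_trans h /h.
apply: contrapT => /forallNP noeps.
have cvg0 : weighted_integral (h_ n) @[n --> \oo] --> 0%E.
  rewrite -[X in _ --> X](@integral0 _ _ R mu [set` T]).
  apply: (@dominated_cvg _ _ _ mu _ mT (fun n t => (h_ n t * f t)%:E) (cst 0%E)
    (fun t => (G t * f t)%:E)).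
  - by move=> n; exact: measurable_weighted.
  - move=> t Tt; apply: cvg_EFin; first by near=> n.
    rewrite -[X in _ --> X](mul0r (f t)); apply: cvgMl; exact: hcvg.
  - by [].
  - apply/integrableP; split; first exact: measurable_weighted.
    under eq_integral => t /[1!inE] Tt do
      rewrite gee0_abs ?lee_fin ?mulr_ge0 ?f0 ?G0//.
    exact: Gfin.
  - move=> n t Tt; have /andP[h0 hGt] := hG n t Tt.
    by rewrite gee0_abs lee_fin ?mulr_ge0 ?f0// ler_wpM2r ?f0.
have : (eps%:E <= limn (fun n => weighted_integral (h_ n)))%E.
  apply: lime_ge; first by apply/cvg_ex; exists 0%E.
  by apply: nearW => n; rewrite leNgt; apply/negP => /ltW; exact: noeps.
by rewrite (cvg_lim _ cvg0)// lee_fin leNgt eps0.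
Unshelve. all: by end_near. Qed.

End WeightedIntegral.
Arguments weighted_integral {R} T%_ring_scope f%_ring_scope h%_ring_scope.

Lemma ler_dist_min (R : realType) (M u v : R) :
  `|Num.min u M - Num.min v M| <= `|u - v|.
Proof.
by case: (leP u M) => ?; case: (leP v M) => ?; case: (ger0P (u - v)) => ?;
  rewrite ?ler_norml; do ?[apply/andP; split]; lra.
Qed.

Lemma ler_dist_max (R : realType) (M u v : R) :
  `|Num.max M u - Num.max M v| <= `|u - v|.
Proof.
by case: (leP M u) => ?; case: (leP M v) => ?; case: (ger0P (u - v)) => ?;
  rewrite ?ler_norml; do ?[apply/andP; split]; lra.
Qed.

Section StepApproximation.
Context (R : realType) (a b : R) (f : R -> R).
Hypothesis intf : intensity `[a, b] f.
Let mu := @lebesgue_measure R.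
Let ab : set R := `[a, b]%classic.

Let mab : measurable ab. Proof. exact: measurable_itv. Qed.

Let Lfin (M : R) : 0 <= M -> (weighted_integral `[a, b] f (fun=> M) < +oo)%E.
Proof.
move=> M0; have -> : (fun=> M) = (fun t : R => M * (fun=> 1) t).
  by apply/funext => t; rewrite mulr1.
rewrite (weighted_integralZ intf)//; apply: lte_mul_pinfty => //.
rewrite /weighted_integral; under eq_integral do rewrite mul1r.
by case: intf => _ _ /(_ `[a, b]); apply; exists a, b; split; exact: subset_refl.
Qed.

Definition grid_index (N : nat) (t : R) : nat := Num.truncn ((t - a) * N.+1%:R).

Definition grid_size (N : nat) : nat := (grid_index N b).+1.

Definition grid_point (N i : nat) : R := a + i%:R / N.+1%:R.

Definition grid_cell (N i : nat) : interval R :=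
  (`[grid_point N i, grid_point N i.+1[ `&` `[a, b])%O.

Lemma grid_cellE N i t :
  t \in grid_cell N i = (t \in `[a, b]) && (grid_index N t == i).
Proof.
have -> : t \in grid_cell N i =
    (t \in `[grid_point N i, grid_point N i.+1[) && (t \in `[a, b]).
  have := set_itvI `[grid_point N i, grid_point N i.+1[ `[a, b].
  by move=> /seteqP[+ +] => /(_ t)/= h1 /(_ t)/= h2; apply/idP/andP.
rewrite andbC; case tab : (t \in `[a, b]) => //=; move: tab.
rewrite !in_itv/= => /andP[at_ tb].
have N0 : 0 < N.+1%:R :> R by [].
rewrite /grid_point -lerBrDl -ltrBlDl ler_pdivrMr// ltr_pdivlMr//.
have ta0 : 0 <= (t - a) * N.+1%:R by rewrite mulr_ge0// subr_ge0.
apply/idP/eqP => [|<-]; last exact: truncn_itv.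
exact: truncn_def.
Qed.

Lemma step_pointwise (c : nat -> R) N t : t \in `[a, b] ->
  \sum_(i < grid_size N) c i * \1_[set` grid_cell N i] t = c (grid_index N t).
Proof.
move=> tab.
have it : (grid_index N t < grid_size N)%N.
  rewrite ltnS; apply: le_truncn; rewrite ler_wpM2r// lerD2r.
  by move: tab; rewrite in_itv/= => /andP[].
rewrite (bigD1 (Ordinal it))//= big1 ?addr0 => [|i ineq].
  by rewrite indicE mem_set ?mulr1//= grid_cellE tab eqxx.
rewrite indicE memNset ?mulr0//= grid_cellE tab/= => /eqP it'.
by move/eqP: ineq; apply; apply/val_inj.
Qed.

Lemma grid_point_cvg t : t \in `[a, b] ->
  grid_point N (grid_index N t) @[N --> \oo] --> t.
Proof.
rewrite in_itv/= => /andP[at_ tb].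
apply/cvgrPdist_le => e e0; near=> N.
have N0 : 0 < N.+1%:R :> R by [].
have ta0 : 0 <= (t - a) * N.+1%:R by rewrite mulr_ge0// subr_ge0.
have /andP[h1 h2] := truncn_itv ta0.
rewrite /grid_point /grid_index.
set k := Num.truncn _ in h1 h2 *.
have h3 : k%:R / N.+1%:R <= t - a by rewrite ler_pdivrMr.
have h4 : t - a < k.+1%:R / N.+1%:R by rewrite ltr_pdivlMr.
have h5 : N.+1%:R^-1 <= e.
  near: N; exists (Num.truncn e^-1) => // N /= eN.
  rewrite invf_ple ?posrE//.
  have ei0 : 0 < e^-1 by rewrite invr_gt0.
  have /andP[_ /ltW/le_trans] := truncn_itv (ltW ei0); apply.
  by rewrite ler_nat ltnS.
move: h4; rewrite -natr1 mulrDl mul1r => h4.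
clearbody k; move: h3 h4 h5; set u := _ / _; set v := _^-1 => h3 h4 h5.
rewrite ler_norml; apply/andP; split; lra.
Unshelve. all: by end_near. Qed.

(** The value on a cell is that of [c] at the left end of the cell; this
    converges pointwise by continuity, under a constant bound. *)
Lemma continuous_step_approximation (c : R -> R) (M eps : R) :
  continuous c -> (forall t, `|c t| <= M) -> 0 < eps ->
  exists N, (weighted_integral `[a, b] f (fun t => `|c t -
    \sum_(i < grid_size N) c (grid_point N i) * \1_[set` grid_cell N i] t|)%R
    <= eps%:E)%E.
Proof.
move=> cc cM eps0.
have M0 : 0 <= M by exact: le_trans (cM 0).
have mc : measurable_fun ab c by apply: measurable_funTS; exact: continuous_measurable_fun.
apply: (weighted_integral_small intf (G := fun=> M + M)) => //.
- move=> N; apply: measurableT_comp => //; apply: measurable_funB => //.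
  apply: measurable_sum => i; exact: measurable_funM.
- move=> N t tab; rewrite normr_ge0/= (step_pointwise (fun i => c (grid_point N i)))//.
  by rewrite (le_trans (ler_normB _ _))// lerD.
- exact/Lfin/addr_ge0.
- move=> t tab; under eq_fun => N do
    rewrite (step_pointwise (fun i => c (grid_point N i)))//.
  apply/cvgr0Pnorm_le => e e0; near=> N; rewrite normr_id.
  near: N.
  have : c (grid_point N (grid_index N t)) @[N --> \oo] --> c t.
    apply: continuous_cvg; first exact: cc.
    exact: grid_point_cvg.
  by move=> /cvgrPdist_le; apply.
Unshelve. all: by end_near. Qed.

Definition clip (M x : R) : R := Num.max (- M) (Num.min x M).

Lemma clip_bound M x : 0 <= M -> `|clip M x| <= M.
Proof.
move=> M0; rewrite ler_norml /clip; apply/andP; split.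
  by rewrite le_max lexx.
by rewrite ge_max (le_trans _ M0) ?oppr_le0//= ge_min lexx orbT.
Qed.

(** Clipping an approximant at a bound of the approximated function does not
    increase the error. *)
Lemma clip_dist M x y : `|y| <= M -> `|y - clip M x| <= `|y - x|.
Proof.
move=> yM; have M0 : 0 <= M by exact: le_trans yM.
move: yM; rewrite ler_norml => /andP[My yM].
rewrite /clip; case: (leP x M) => xM.
  case: (leP (- M) x) => // Mx.
  rewrite !ger0_norm ?subr_ge0 ?lerD2l ?lerN2 ?(ltW Mx)//.
  exact: le_trans (ltW Mx) My.
rewrite max_r; last by rewrite (le_trans _ M0)// oppr_le0.
rewrite distrC [leRHS]distrC !ger0_norm ?subr_ge0//.
  by rewrite lerD2r ltW.
exact: le_trans yM (ltW xM).
Qed.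

Lemma clip_lipschitz M x y : `|clip M x - clip M y| <= `|x - y|.
Proof. exact: le_trans (ler_dist_max _ _ _) (ler_dist_min _ _ _). Qed.

Lemma continuous_clip M (c : R -> R) : continuous c ->
  continuous (fun t => clip M (c t)).
Proof.
move=> cc t; apply/cvgrPdist_le => e e0; near=> s.
rewrite (le_trans (clip_lipschitz _ _ _))//.
by near: s; have /cvgrPdist_le := cc t; apply.
Unshelve. all: by end_near. Qed.

(** Continuous functions are dense for the Lebesgue integral, which controls the
    weighted error where [f <= K]; the rest of the interval has small weight, and
    there the error is at most [2 M]. *)
Lemma bounded_step_approximation (h : R -> R) (M eps : R) :
  0 <= M -> measurable_fun ab h -> (forall t, ab t -> `|h t| <= M) -> 0 < eps ->
  exists N (c : nat -> R), (forall i, `|c i| <= M) /\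
    (weighted_integral `[a, b] f (fun t => `|h t -
      \sum_(i < grid_size N) c i * \1_[set` grid_cell N i] t|)%R <= eps%:E)%E.
Proof.
move=> M0 mh hM eps0.
have mf : measurable_fun ab f by case: intf.
have f0 t : ab t -> 0 <= f t by case: intf => _ + _; apply.
have e4 : 0 < eps / 4 by rewrite divr_gt0.
(* The part of the interval where the density is large. *)
pose A (K : nat) := ab `&` [set t | K%:R < f t].
have mA K : measurable (A K).
  have := mf mab `]K%:R, +oo[%classic (measurable_itv _).
  congr measurable; apply/seteqP; split=> t [tab /= ft]; split=> //=.
    by move: ft; rewrite in_itv/= andbT.
  by rewrite in_itv/= andbT.
have [K AK] : exists K, (weighted_integral `[a, b] f
    (fun t => (M + M) * \1_(A K) t)%R <= (eps / 4)%:E)%E.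
  apply: (weighted_integral_small intf (G := fun=> M + M)) => //.
  - by move=> K; apply: measurable_funM => //; exact: measurable_indic.
  - move=> K t _; rewrite mulr_ge0 ?addr_ge0//= -[leRHS]mulr1 ler_wpM2l ?addr_ge0//.
  - exact/Lfin/addr_ge0.
  - move=> t tab; apply: cvg_near_cst; near=> K.
    rewrite indicE memNset ?mulr0// => -[_ /=]; apply/negP; rewrite -leNgt.
    near: K; exists (Num.truncn (f t)).+1 => // n /= fn.
    have /andP[_ /ltW/le_trans] := truncn_itv (f0 _ tab); apply.
    by rewrite ler_nat.
have leb_fin : (mu ab < +oo)%E.
  by rewrite /mu /ab lebesgue_measure_itv/=; case: ifP => // _; rewrite -EFinB ltry.
have inth : mu.-integrable ab (EFin \o h).
  apply: measurable_bounded_integrable => //.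
  by exists M; split; rewrite ?num_real// => x Mx t /hM /le_trans; apply; exact: ltW.
have [g_ [g_c _ g_cvg]] := approximation_continuous_integrable mab leb_fin inth.
have [m gm] : exists m, (\int[mu]_(t in ab) `|(h t - g_ m t)%:E| <=
    (eps / 4 / K.+1%:R)%:E)%E.
  have eK : 0 < eps / 4 / K.+1%:R by rewrite divr_gt0.
  apply: contrapT => /forallNP noeps.
  have : ((eps / 4 / K.+1%:R)%:E <=
      limn (fun m => \int[mu]_(t in ab) `|(h t - g_ m t)%:E|))%E.
    apply: lime_ge; first by apply/cvg_ex; exists 0%E.
    by apply: nearW => n; rewrite leNgt; apply/negP => /ltW; exact: noeps.
  by rewrite (cvg_lim _ g_cvg)// lee_fin leNgt eK.
pose c t := clip M (g_ m t).
have cc : continuous c by exact/continuous_clip/g_c.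
have cM t : `|c t| <= M by exact: clip_bound.
have mc : measurable_fun ab c by apply: measurable_funTS; exact: continuous_measurable_fun.
have e2 : 0 < eps / 2 by rewrite divr_gt0.
(* The error splits into [h - c], at most [eps / 2] in total, and the error of
   the step approximation of the continuous function [c]. *)
have [N cN] := continuous_step_approximation cc cM e2.
exists N, (fun i => c (grid_point N i)); split=> //.
pose phi t := \sum_(i < grid_size N)
  c (grid_point N i) * \1_[set` grid_cell N i] t.
have {}cN : (weighted_integral `[a, b] f (fun t => `|c t - phi t|)%R <=
  (eps / 2)%:E)%E := cN.
suff : (weighted_integral `[a, b] f (fun t => `|h t - phi t|)%R <= eps%:E)%E by [].
have mphi : measurable_fun ab phi.
  by apply: measurable_sum => i; exact: measurable_funM.
have hc : (weighted_integral `[a, b] f (fun t => `|h t - c t|)%R <= (eps / 2)%:E)%E.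
  have -> : eps / 2 = K.+1%:R * (eps / 4 / K.+1%:R) + eps / 4.
    by rewrite [X in X + _]mulrC divfK ?pnatr_eq0//; lra.
  rewrite EFinD EFinM.
  apply: (@le_trans _ _ (K.+1%:R%:E * \int[mu]_(t in ab) `|(h t - g_ m t)%:E| +
      weighted_integral `[a, b] f (fun t => (M + M) * \1_(A K) t)%R)%E); last first.
    by rewrite leeD// lee_wpmul2l// lee_fin.
  have mhg : measurable_fun ab (fun t => `|(h t - g_ m t)%:E|)%E.
    apply: measurableT_comp => //; apply/measurable_EFinP; apply: measurable_funB => //.
    by apply: measurable_funTS; exact: continuous_measurable_fun.
  have mAf : measurable_fun ab (fun t => ((M + M) * \1_(A K) t * f t)%:E).
    by apply/measurable_EFinP; do 2!apply: measurable_funM => //; exact: measurable_indic.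
  rewrite -ge0_integralZl_EFin// -ge0_integralD//; last 2 first.
  - by apply: measurable_funeM.
  - move=> t tab; rewrite lee_fin mulr_ge0 ?f0// mulr_ge0 ?addr_ge0//.
  apply: ge0_le_integral => //.
  - by move=> t tab; rewrite lee_fin mulr_ge0 ?f0.
  - apply: (measurable_weighted intf); apply: measurableT_comp => //.
    exact: measurable_funB.
  - by apply: emeasurable_funD => //; exact: measurable_funeM.
  - move=> t tab; rewrite -EFinM -EFinD lee_fin.
    have ht := hM t tab; have ft := f0 t tab.
    have hct : `|h t - c t| <= `|h t - g_ m t| by exact: clip_dist.
    case: (leP (f t) K%:R) => ftK.
      rewrite -[leLHS]addr0 lerD//.
        rewrite mulrC ler_pM// (le_trans ftK)// ler_nat//.
      by rewrite !mulr_ge0 ?addr_ge0.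
    rewrite indicE mem_set ?mulr1//.
    rewrite -[leLHS]add0r lerD// ?mulr_ge0// ler_wpM2r//.
    by rewrite (le_trans (ler_normB _ _))// lerD.
have mhc : measurable_fun ab (fun t => `|h t - c t|).
  by apply: measurableT_comp => //; exact: measurable_funB.
have mcp : measurable_fun ab (fun t => `|c t - phi t|).
  by apply: measurableT_comp => //; exact: measurable_funB.
have -> : eps = eps / 2 + eps / 2 by lra.
rewrite EFinD; apply: le_trans (leeD hc cN).
rewrite -(weighted_integralD intf)//.
apply: (le_weighted_integral intf).
- by apply: measurableT_comp => //; exact: measurable_funB.
- exact: measurable_funD.
- move=> t tab; rewrite normr_ge0/=.
  by rewrite (le_trans _ (ler_normD _ _))// addrA subrK.
Unshelve. all: by end_near. Qed.

End StepApproximation.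

Lemma intensity_sub (R : realType) (T : interval R) (f : R -> R) (a b : R) :
  intensity T f -> `[a, b] `<=` [set` T] -> intensity `[a, b] f.
Proof.
move=> [mf f0 ff] abT; split.
- by apply: measurable_funS mf => //; exact: measurable_itv.
- by move=> t /abT; exact: f0.
- move=> J [c [d [Jcd cdab]]]; apply: ff; exists c, d; split=> //.
  exact: subset_trans abT.
Qed.

Lemma weighted_integral_support (R : realType) (T S : interval R) (f h : R -> R) :
  [set` S] `<=` [set` T] -> (forall t, ~ [set` S] t -> h t = 0) ->
  weighted_integral T f h = weighted_integral S f h.
Proof.
move=> ST h0; rewrite /weighted_integral [in LHS]integral_mkcond [in RHS]integral_mkcond.
apply: eq_integral => t _; rewrite !patchE.
case: ifPn => [_|tT]; case: ifPn => // tS.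
  by rewrite h0 ?mul0r//; move: tS; rewrite notin_setE.
by move: tT; rewrite notin_setE => -[]; apply: ST; rewrite inE in tS.
Qed.

(** The factorization of [x ^ q - y ^ q]. *)
Lemma exprn_lipschitz (R : realType) (M x y : R) (q : nat) :
  `|x| <= M -> `|y| <= M -> `|x ^+ q - y ^+ q| <= q%:R * M ^+ q.-1 * `|x - y|.
Proof.
move=> xM yM; have M0 : 0 <= M by exact: le_trans xM.
rewrite subrXX normrM mulrC ler_wpM2r//.
rewrite (le_trans (ler_norm_sum _ _ _))//.
rewrite mulr_natl -[X in _ <= _ *+ X]card_ord -sumr_const; apply: ler_sum => i _.
rewrite normrM !normrX.
have -> : M ^+ q.-1 = M ^+ (q.-1 - i) * M ^+ i.
  by rewrite -exprD subnK//; have := ltn_ord i; lia.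
by rewrite ler_pM ?exprn_ge0// lerXn2r// ?nnegrE.
Qed.

(** Step functions on finitely many disjoint intervals approximate [g] for the
    mean measure, with weighted moments that stay close to those of [g].  The
    control of the moments comes from truncating [g] first: on bounded functions
    [x ^+ q] is Lipschitz. *)
Lemma step_approximation (R : realType) (T : interval R) (f g : R -> R) (Q : nat)
    (eps : R) :
  intensity T f -> measurable_fun [set` T] g ->
  (weighted_integral T f (fun t => `|g t|)%R < +oo)%E -> 0 < eps ->
  exists l (J : 'I_l -> interval R) (c : 'I_l -> R),
    [/\ forall i, subintervals T (J i), trivIset setT (fun i => [set` J i]),
     (weighted_integral T f
        (fun t => `|g t - \sum_(i < l) c i * \1_[set` J i] t|)%R <= eps%:E)%E &
     forall q, (q <= Q)%N -> (weighted_integral T f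
        (fun t => `|\sum_(i < l) c i * \1_[set` J i] t| ^+ q)%R <=
        weighted_integral T f (fun t => `|g t| ^+ q)%R + 1)%E].
Proof.
move=> intf mg gfin eps0.
have mT : measurable [set` T] by exact: measurable_itv.
have [a [b [abT abM abU]]] := itv_exhaustion T.
have mng : measurable_fun [set` T] (fun t => `|g t|) by exact: measurableT_comp.
(* Restrict [g] to a compact interval and to the points where it is bounded. *)
pose E m := `[a m, b m] `&` ([set` T] `&` (fun t => `|g t|) @^-1` `]-oo, m%:R]).
have mE m : measurable (E m).
  by apply: measurableI; [exact: measurable_itv|apply: mng => //; exact: measurable_itv].
pose g_ m t := g t * \1_(E m) t.
have mg_ m : measurable_fun [set` T] (g_ m).
  by apply: measurable_funM => //; exact: measurable_indic.
have g_le m t : `|g_ m t| <= `|g t|.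
  rewrite /g_ normrM -[leRHS]mulr1 ler_wpM2l//.
  by rewrite indicE; case: (_ \in _); rewrite ?normr1 ?normr0.
have g_bound m t : `|g_ m t| <= m%:R.
  rewrite /g_ indicE; case: (boolP (t \in E m)) => [|_]; last by rewrite mulr0 normr0.
  by rewrite inE mulr1 => -[_ [_]]; rewrite /= in_itv.
have e2 : 0 < eps / 2 by rewrite divr_gt0.
have [m gm] : exists m,
    (weighted_integral T f (fun t => `|g t - g_ m t|)%R <= (eps / 2)%:E)%E.
  apply: (weighted_integral_small intf (G := fun t => `|g t|)) => //.
  - by move=> m; apply: measurableT_comp => //; exact: measurable_funB.
  - move=> m t Tt; rewrite normr_ge0/= /g_ indicE; case: (_ \in _) => /=.
      by rewrite mulr1 subrr normr0.
    by rewrite mulr0 subr0.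
  - move=> t Tt; apply: cvg_near_cst.
    have : (\bigcup_m `[a m, b m]%classic) t by rewrite abU.
    move=> [i _ abt]; near=> m.
    rewrite /g_ indicE mem_set ?mulr1 ?subrr ?normr0//; split; last split => //=.
      apply: (abM i) => //.
      by near: m; exists i.
    rewrite in_itv/=.
    have /andP[_ /ltW/le_trans] := truncn_itv (normr_ge0 (g t)); apply.
    rewrite ler_nat; near: m.
    by exists (Num.truncn `|g t|).+1.
pose M : R := m%:R + 1.
have M1 : 1 <= M by rewrite lerDr.
have M0 : 0 <= M by exact: le_trans M1.
have mM : m%:R <= M by rewrite lerDl.
(* [Q * M ^ Q] is a common Lipschitz constant of the powers up to [Q] on
   [[-M, M]]; the step function must be that much closer to [g_ m]. *)
pose D : R := Q%:R * M ^+ Q + 1.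
have D0 : 0 < D by rewrite ltr_wpDl// mulr_ge0// exprn_ge0.
pose delta := Num.min (eps / 2) D^-1.
have delta0 : 0 < delta by rewrite lt_min e2 invr_gt0.
have intab := intensity_sub intf (abT m).
have mgab : measurable_fun `[a m, b m]%classic (g_ m).
  by apply: measurable_funS (mg_ m) => //; exact: abT.
have [N [c [cM cN]]] := bounded_step_approximation intab (ler0n _ m) mgab
  (fun t _ => g_bound m t) delta0.
pose phi t := \sum_(i < grid_size (a m) (b m) N) c i *
  \1_[set` grid_cell (a m) (b m) N i] t.
have {}cN : (weighted_integral `[a m, b m] f (fun t => `|g_ m t - phi t|)%R
    <= delta%:E)%E := cN.
have cellab i : [set` grid_cell (a m) (b m) N i] `<=` `[a m, b m].
  by move=> t; rewrite /= grid_cellE => /andP[].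
have phi0 t : ~ `[a m, b m]%classic t -> phi t = 0.
  move=> tab; rewrite /phi big1// => i _.
  by rewrite indicE memNset ?mulr0// => /cellab.
have phiM t : `|phi t| <= m%:R.
  case: (boolP (t \in `[a m, b m])) => tab; first by rewrite /phi step_pointwise.
  by rewrite phi0 ?normr0//; apply/negP.
have mphi : measurable_fun [set` T] phi.
  by apply: measurable_sum => i; exact: measurable_funM.
have gphi : (weighted_integral T f (fun t => `|g_ m t - phi t|)%R <= delta%:E)%E.
  rewrite (weighted_integral_support (S := `[a m, b m]))//.
  move=> t tab; rewrite phi0// /g_ indicE memNset ?mulr0 ?subrr ?normr0//.
  by case.
have mgphi : measurable_fun [set` T] (fun t => `|g_ m t - phi t|).
  by apply: measurableT_comp => //; exact: measurable_funB.
exists (grid_size (a m) (b m) N), (grid_cell (a m) (b m) N), c; split.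
- by move=> i; exists (a m), (b m); split; [exact: cellab|exact: abT].
- move=> i j _ _ [t [/=]]; rewrite !grid_cellE => /andP[_ /eqP ti] /andP[_ /eqP tj].
  by apply/val_inj; rewrite /= -ti -tj.
- have -> : eps = eps / 2 + eps / 2 by lra.
  have dle : (delta%:E <= (eps / 2)%:E)%E by rewrite lee_fin ge_min lexx.
  rewrite EFinD; apply: le_trans (leeD gm (le_trans gphi dle)).
  rewrite -(weighted_integralD intf)//; last first.
    by apply: measurableT_comp => //; exact: measurable_funB.
  apply: (le_weighted_integral intf).
  + by apply: measurableT_comp => //; exact: measurable_funB.
  + apply: measurable_funD => //.
    by apply: measurableT_comp => //; exact: measurable_funB.
  + move=> t _; rewrite normr_ge0/=.
    by rewrite (le_trans _ (ler_normD _ _))// addrA subrK.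
- move=> q qQ.
  have Dq : ((Q%:R * M ^+ Q)%:E * weighted_integral T f (fun t => `|g_ m t - phi t|)%R
      <= 1)%E.
    apply: (@le_trans _ _ ((Q%:R * M ^+ Q)%:E * delta%:E)%E).
      by rewrite lee_wpmul2l// lee_fin mulr_ge0// exprn_ge0.
    rewrite -EFinM lee_fin (@le_trans _ _ (D * D^-1))//.
      by rewrite ler_pM ?mulr_ge0 ?exprn_ge0 ?(ltW delta0)// ?lerDl// ge_min lexx orbT.
    by rewrite mulfV// gt_eqF.
  apply: le_trans (leeD (lexx _) Dq).
  have mgq : measurable_fun [set` T] (fun t => `|g t| ^+ q) by exact: measurable_funX.
  have QM0 : 0 <= Q%:R * M ^+ Q by rewrite mulr_ge0// exprn_ge0.
  rewrite -(weighted_integralZ intf)// -(weighted_integralD intf)//; last 2 first.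
  + by apply: measurable_funM.
  + by move=> t _; rewrite mulr_ge0.
  apply: (le_weighted_integral intf).
  + by apply: measurable_funX; exact: measurableT_comp.
  + by apply: measurable_funD => //; exact: measurable_funM.
  + move=> t _; rewrite exprn_ge0//=.
    have qM : q%:R * M ^+ q.-1 <= Q%:R * M ^+ Q.
      rewrite ler_pM ?exprn_ge0 ?ler_nat//.
      by rewrite ler_weXn2l// (leq_trans (leq_pred _)).
    have lip := @exprn_lipschitz _ M `|phi t| `|g_ m t| q.
    rewrite !normr_id in lip.
    have {}lip := lip (le_trans (phiM t) mM) (le_trans (g_bound m t) mM).
    have gq : `|g_ m t| ^+ q <= `|g t| ^+ q by rewrite lerXn2r// nnegrE.
    have d1 : `| `|phi t| - `|g_ m t| | <= `|g_ m t - phi t|.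
      by rewrite [leRHS]distrC; exact: ler_dist_dist.
    have d2 : q%:R * M ^+ q.-1 * `| `|phi t| - `|g_ m t| | <=
        Q%:R * M ^+ Q * `|g_ m t - phi t|.
      by rewrite ler_pM ?mulr_ge0 ?exprn_ge0.
    have := le_trans (ler_norm _) (le_trans lip d2).
    rewrite lerBlDl => /le_trans; apply; exact: lerD.
Unshelve. all: by end_near. Qed.

(** * Moments of the empirical moment *)

(** At most one term of the sum is nonzero. *)
Lemma step_map (R : realType) (l : nat) (J : 'I_l -> interval R) (c : 'I_l -> R)
    (F : R -> R) t : trivIset setT (fun i => [set` J i]) -> F 0 = 0 ->
  F (\sum_(i < l) c i * \1_[set` J i] t) = \sum_(i < l) F (c i) * \1_[set` J i] t.
Proof.
move=> dJ F0; have [[i it]|/forallNP noi] := pselect (exists i, [set` J i] t).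
  have only k : k != i -> \1_[set` J k] t = 0 :> R.
    move=> ki; rewrite indicE memNset// => kt.
    by move/eqP: ki; apply; apply: dJ => //; exists t.
  rewrite (bigD1 i)//= [in RHS](bigD1 i)//= !big1 ?addr0 => [|k /only->|k /only->];
    rewrite ?mulr0//.
  by rewrite indicE mem_set ?mulr1.
have nil k : \1_[set` J k] t = 0 :> R.
  by rewrite indicE memNset//; exact: noi.
by rewrite !big1 => [|k _|k _]; rewrite ?nil ?mulr0.
Qed.

Lemma Rintegral_dist d (T : measurableType d) (R : realType)
    (nu : {measure set T -> \bar R}) (D : set T) (g h : T -> R) :
  measurable D -> nu.-integrable D (EFin \o g) -> nu.-integrable D (EFin \o h) ->
  (`|\int[nu]_(t in D) g t - \int[nu]_(t in D) h t|%:E <=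
   \int[nu]_(t in D) `|g t - h t|%:E)%E.
Proof.
move=> mD ig ih; rewrite -RintegralB// -abse_EFin.
have igh : nu.-integrable D (fun t => (g t - h t)%:E).
  by under eq_fun do rewrite EFinB; exact: integrableB.
rewrite /Rintegral fineK; last exact: integrable_fin_num.
by apply: le_abse_integral => //; exact: measurable_int igh.
Qed.

Section CampbellWithin.
Context d (Omega : measurableType d) (R : realType) (P : probability Omega R).
Context (T : interval R) (f : R -> R).
Context (X : Omega -> {measure set (measurableTypeR R) -> \bar R}).
Hypothesis intf : intensity T f.
Hypothesis poisX : poisson_process P T f X.
Let D : set (measurableTypeR R) := [set` T].

Let mD : measurable D. Proof. exact: measurable_itv. Qed.

Lemma campbell_within (h : measurableTypeR R -> R) :
  measurable_fun D h -> (forall t, D t -> 0 <= h t) ->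
  measurable_fun setT (fun w => \int[X w]_(t in D) (h t)%:E)%E /\
  (\int[P]_w \int[X w]_(t in D) (h t)%:E = weighted_integral T f h)%E.
Proof.
move=> mh h0.
have E (nu : {measure set (measurableTypeR R) -> \bar R}) :
    (\int[nu]_(t in D) (h t)%:E =
    \int[nu]_(t in D) ((EFin \o h) \_ D) t)%E.
  by apply: eq_integral => t tD; rewrite patchE tD.
have mhD : measurable_fun setT ((EFin \o h) \_ D).
  by apply: (measurable_restrictT _ mD).1; exact/measurable_EFinP.
have hD0 t : (0 <= ((EFin \o h) \_ D) t)%E.
  by rewrite patchE; case: ifPn => // tD; rewrite lee_fin h0// -inE.
have [mX EX] := campbell intf poisX hD0 mhD.
under eq_fun do rewrite E.
split=> //; rewrite EX /weighted_integral; apply: eq_integral => t tD.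
by rewrite patchE tD.
Qed.

Lemma measurable_Rintegral_process (g : measurableTypeR R -> R) :
  measurable_fun D g -> measurable_fun setT (fun w => \int[X w]_(t in D) g t).
Proof.
move=> mg; apply: (measurableT_comp (f := fine)) => //.
have pm w : (\int[X w]_(t in D) (g t)%:E =
  \int[X w]_(t in D) (Num.max (g t) 0)%:E - \int[X w]_(t in D) (Num.max (- g t) 0)%:E)%E.
  rewrite integralE; congr (_ - _)%E; apply: eq_integral => t _.
    by rewrite funeposE EFin_max.
  by rewrite funenegE -EFinN EFin_max.
under eq_fun do rewrite pm.
apply: emeasurable_funB.
- apply: (campbell_within _ _).1 => [|t _]; first exact: measurable_maxr.
  by rewrite le_max lexx orbT.
- apply: (campbell_within _ _).1 => [|t _]; last by rewrite le_max lexx orbT.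
  by apply: measurable_maxr => //; exact: measurableT_comp.
Qed.

(** By Campbell's formula for [`|g|]. *)
Lemma ae_integrable_process (g : measurableTypeR R -> R) :
  measurable_fun D g -> (weighted_integral T f (fun t => `|g t|)%R < +oo)%E ->
  {ae P, forall w, (X w).-integrable D (EFin \o g)}.
Proof.
move=> mg gfin.
have mng : measurable_fun D (fun t => `|g t|) by exact: measurableT_comp.
have [mX EX] := campbell_within mng (fun t _ => normr_ge0 (g t)).
have iX : P.-integrable setT (fun w => \int[X w]_(t in D) `|g t|%:E)%E.
  apply/integrableP; split=> //.
  under eq_integral do rewrite gee0_abs ?integral_ge0//.
  by rewrite EX.
have := integrable_ae measurableT iX; apply: filterS => w /(_ I) fin.
apply/integrableP; split; first exact/measurable_EFinP.
by rewrite -ge0_fin_numE// integral_ge0.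
Qed.

End CampbellWithin.

Section EmpiricalMomentBound.
Context (R : realType) (T : interval R) (f g : R -> R).
Hypothesis intf : intensity T f.
Hypothesis mg : measurable_fun [set` T] g.
Hypothesis gfin : forall q, (0 < q)%N ->
  (weighted_integral T f (fun t => `|g t| ^+ q)%R < +oo)%E.
Let mu := @lebesgue_measure R.
Let D : set (measurableTypeR R) := [set` T].

Let mD : measurable D. Proof. exact: measurable_itv. Qed.

Let mf : measurable_fun D f. Proof. by case: intf. Qed.

Let f0 t : D t -> 0 <= f t. Proof. by case: intf => _ + _; apply. Qed.

Let gfin1 : (weighted_integral T f (fun t => `|g t|)%R < +oo)%E.
Proof. exact: (gfin (ltn0Sn 0)). Qed.

Lemma integrable_weighted (h : R -> R) : measurable_fun D h ->
  (weighted_integral T f (fun t => `|h t|)%R < +oo)%E ->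
  mu.-integrable D (fun t => (h t * f t)%:E).
Proof.
move=> mh hfin; apply/integrableP; split.
  exact: (measurable_weighted intf).
apply: le_lt_trans hfin; rewrite le_eqVlt; apply/orP; left; apply/eqP.
apply: eq_integral => t.
by rewrite inE => Dt; rewrite abse_EFin normrM (ger0_norm (f0 Dt)).
Qed.

Section Step.
Context (l : nat) (J : 'I_l -> interval R) (c : 'I_l -> R).
Hypothesis TJ : forall i, subintervals T (J i).
Hypothesis dJ : trivIset setT (fun i => [set` J i]).

Definition step t := \sum_(i < l) c i * \1_[set` J i] t.

Let JD i : [set` J i] `<=` D.
Proof. by have [a [b [Jab abT]]] := TJ i; exact: subset_trans abT. Qed.

Let r i := \int[mu]_(t in [set` J i]) f t.

Let rE i : (\int[mu]_(t in D) (\1_[set` J i] t * f t)%:E = (r i)%:E)%E.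
Proof.
rewrite /r /Rintegral fineK; last first.
  rewrite ge0_fin_numE; first by case: intf => _ _; apply; exact: TJ.
  by apply: integral_ge0 => t /JD /f0; rewrite lee_fin.
transitivity (\int[mu]_(t in D `&` [set` J i]) (f t)%:E)%E; last first.
  by rewrite setIidr//; exact: JD.
rewrite [in RHS]integral_mkcondr; apply: eq_integral => t _.
by rewrite patchE indicE; case: (t \in _); rewrite ?mul1r ?mul0r.
Qed.

Let mind i : measurable_fun D (\1_[set` J i] : _ -> R).
Proof. exact: measurable_indic. Qed.

Lemma measurable_step : measurable_fun D step.
Proof. by apply: measurable_sum => i; exact: measurable_funM. Qed.

Lemma weighted_integral_step q : (0 < q)%N ->
  weighted_integral T f (fun t => `|step t| ^+ q) =
  (\sum_(i < l) `|c i| ^+ q * r i)%:E.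
Proof.
move=> q0.
transitivity (\int[mu]_(t in D)
    \sum_(i < l) (`|c i| ^+ q)%:E * (\1_[set` J i] t * f t)%:E)%E.
  apply: eq_integral => t _; rewrite /step.
  rewrite (step_map c (F := fun x => `|x| ^+ q))//; last first.
    by rewrite normr0 expr0n eqn0Ngt q0.
  rewrite mulr_suml -sumEFin; apply: eq_bigr => i _.
  by rewrite -EFinM mulrA.
have mi i : measurable_fun D (fun t => (\1_[set` J i] t * f t)%:E).
  exact: (measurable_weighted intf (mind i)).
rewrite ge0_integral_sum//; last 2 first.
- by move=> i; apply: measurable_funeM; exact: mi.
- by move=> i t Dt; rewrite mule_ge0// lee_fin ?exprn_ge0// mulr_ge0 ?f0.
rewrite -sumEFin; apply: eq_bigr => i _.
rewrite ge0_integralZl_EFin ?exprn_ge0//; first by rewrite rE EFinM.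
- by move=> t Dt; rewrite lee_fin mulr_ge0 ?f0.
Qed.

Lemma integrable_step (h : R -> R) (nu : {measure set (measurableTypeR R) -> \bar R}) :
  (forall i, nu.-integrable D (fun t => (\1_[set` J i] t * h t)%:E)) ->
  nu.-integrable D (fun t => (step t * h t)%:E) /\
  \int[nu]_(t in D) (step t * h t) =
  \sum_(i < l) c i * \int[nu]_(t in D) (\1_[set` J i] t * h t).
Proof.
move=> ih.
have E : (fun t => (step t * h t)%:E) =
    (fun t => \sum_(i < l) (c i)%:E * (\1_[set` J i] t * h t)%:E)%E.
  apply/funext => t; rewrite /step mulr_suml -sumEFin.
  by apply: eq_bigr => i _; rewrite -EFinM mulrA.
have ich i : nu.-integrable D (fun t => (c i)%:E * (\1_[set` J i] t * h t)%:E)%E.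
  by apply: integrableZl => //; exact: ih.
split; first by rewrite E; exact: integrable_sum.
rewrite /Rintegral E integral_sum// -sum_fine; last first.
  by move=> i _; apply: integrable_fin_num.
apply: eq_bigr => i _; rewrite integralZl//= fineM//.
by apply: integrable_fin_num => //; exact: ih.
Qed.

Lemma Rintegral_weighted_step :
  mu.-integrable D (fun t => (step t * f t)%:E) /\
  \int[mu]_(t in D) (step t * f t) = \sum_(i < l) c i * r i.
Proof.
have [|i1 i2] := @integrable_step f mu.
  move=> i; apply: integrable_weighted => //.
  under [X in weighted_integral _ _ X]eq_fun do rewrite ger0_norm//.
  by rewrite /weighted_integral rE ltry.
split=> //; rewrite i2; apply: eq_bigr => i _.
by rewrite /Rintegral rE.
Qed.

Lemma Rintegral_counting_step (nu : {measure set (measurableTypeR R) -> \bar R}) :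
  (forall i, (nu [set` J i] < +oo)%E) ->
  nu.-integrable D (EFin \o step) /\
  \int[nu]_(t in D) step t = \sum_(i < l) c i * fine (nu [set` J i]).
Proof.
move=> nufin.
have [|i1 i2] := @integrable_step (fun=> 1) nu.
  move=> i; under eq_fun do rewrite mulr1.
  apply/integrableP; split; first exact/measurable_EFinP.
  under eq_integral do rewrite gee0_abs ?lee_fin//.
  by rewrite integral_indic// setIidl//; exact: nufin.
split.
  by move: i1; congr (_.-integrable _ _); apply/funext => t; rewrite /= mulr1.
under eq_Rintegral do rewrite -[step _]mulr1.
rewrite i2; apply: eq_bigr => i _; rewrite /Rintegral.
under eq_integral do rewrite mulr1.
by rewrite integral_indic// setIidl.
Qed.

End Step.

Section Deviation.
Context d (Omega : measurableType d) (P : probability Omega R) (n : nat).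
Context (X : 'I_n -> Omega -> {measure set (measurableTypeR R) -> \bar R}).
Hypothesis iidX : iid_poisson_processes P T f X.

Let m0 := \int[mu]_(t in D) (g t * f t).

(** This is [n] times the deviation of the empirical moment. *)
Definition total_deviation (w : Omega) : R :=
  \sum_(j < n) (\int[X j w]_(t in D) g t - m0).

Lemma measurable_total_deviation : measurable_fun setT total_deviation.
Proof.
apply: measurable_sum => j; apply: measurable_funB => //.
exact: (measurable_Rintegral_process intf (iidX.1 j)).
Qed.

Lemma empirical_momentE w : (0 < n)%N ->
  empirical_moment T g X w - m0 = n%:R^-1 * total_deviation w.
Proof.
move=> n0; rewrite /total_deviation sumrB sumr_const card_ord mulrBr.
by rewrite -[m0 *+ n]mulr_natl mulrA mulVf ?mul1r// pnatr_eq0 -lt0n.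
Qed.

(** For each of the [n] processes the error is at most the integral of
    [`|g t - step t|] against the process, of mean at most [eps] by Campbell's
    formula, plus the difference of the two means, again at most [eps]. *)
Lemma integral_deviation_step (l : nat) (J : 'I_l -> interval R) (c : 'I_l -> R)
    (eps : R) : (forall i, subintervals T (J i)) ->
  trivIset setT (fun i => [set` J i]) -> 0 <= eps ->
  (weighted_integral T f (fun t => `|g t - step J c t|)%R <= eps%:E)%E ->
  (\int[P]_w `|total_deviation w - centred_sum
      (fun a => \int[mu]_(t in [set` J a.2]) f t) (fun a => c a.2)
      (counts X J w)|%:E <= (n%:R * (2 * eps))%:E)%E.
Proof.
move=> TJ dJ eps0 geps.
have mstep := measurable_step J c.
have mgs : measurable_fun D (fun t => `|g t - step J c t|).
  by apply: measurableT_comp => //; exact: measurable_funB.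
pose r i := \int[mu]_(t in [set` J i]) f t.
pose s0 := \sum_(i < l) c i * r i.
have centredE w : centred_sum (fun a => \int[mu]_(t in [set` J a.2]) f t)
    (fun a => c a.2) (counts X J w) =
    \sum_(j < n) (\int[X j w]_(t in D) step J c t - s0).
  transitivity (\sum_(j < n) \sum_(i < l) c i * ((counts X J w (j, i))%:R - r i)).
    by rewrite pair_bigA/=; apply: eq_bigr => -[].
  apply: eq_bigr => j _; rewrite (Rintegral_counting_step c TJ _).2; last first.
    by move=> i; rewrite (countsE iidX)// ltry.
  rewrite /s0 -sumrB; apply: eq_bigr => i _.
  by rewrite (countsE iidX)// mulrBr.
have m0s0 : `|m0 - s0| <= eps.
  have [istep sE] := Rintegral_weighted_step c TJ.
  rewrite /s0 -sE -lee_fin; apply: le_trans geps.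
  apply: (le_trans (Rintegral_dist mD (integrable_weighted mg gfin1) istep)).
  rewrite le_eqVlt; apply/orP; left; apply/eqP.
  apply: eq_integral => t; rewrite inE => Dt.
  by rewrite -mulrBl normrM (ger0_norm (f0 Dt)).
have mI j : measurable_fun setT (fun w => \int[X j w]_(t in D) `|g t - step J c t|%:E)%E.
  exact: (campbell_within intf (iidX.1 j) mgs (fun t _ => normr_ge0 _)).1.
have mZS : measurable_fun setT (fun w => total_deviation w -
    centred_sum (fun a => r a.2) (fun a => c a.2) (counts X J w)).
  apply: measurable_funB; first exact: measurable_total_deviation.
  apply: (poisson_system_measurable (poisson_system_counts iidX TJ dJ f0)).
have ae_le : {ae P, forall w, setT w -> (`|total_deviation w -
    centred_sum (fun a => r a.2) (fun a => c a.2) (counts X J w)|%:E <=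
    \sum_(j < n) (\int[X j w]_(t in D) `|g t - step J c t|%:E + eps%:E))%E}.
  have ae_int : {ae P, forall w, forall j, (X j w).-integrable D (EFin \o g)}.
    apply: filter_forall => j.
    exact: (ae_integrable_process intf (iidX.1 j)).
  apply: filterS ae_int => w iX _.
  rewrite centredE /total_deviation -sumrB.
  apply: (@le_trans _ _ (\sum_(j < n) `|\int[X j w]_(t in D) g t - m0 -
      (\int[X j w]_(t in D) step J c t - s0)|%:E)%E).
    by rewrite sumEFin lee_fin; exact: ler_norm_sum.
  apply: lee_sum => j _.
  have Xfin i : (X j w [set` J i] < +oo)%E by rewrite (countsE iidX)// ltry.
  have [istep _] := Rintegral_counting_step c TJ Xfin.
  apply: (@le_trans _ _ (`|\int[X j w]_(t in D) g t - \int[X j w]_(t in D) step J c t|%:E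
      + `|m0 - s0|%:E)%E).
    rewrite -EFinD lee_fin; apply: le_trans (ler_normB _ _).
    by rewrite le_eqVlt; apply/orP; left; apply/eqP; congr `|_|; lra.
  apply: leeD; last by rewrite lee_fin.
  exact: Rintegral_dist.
apply: (@le_trans _ _ (\int[P]_w
    \sum_(j < n) (\int[X j w]_(t in D) `|g t - step J c t|%:E + eps%:E))%E).
  apply: ae_ge0_le_integral ae_le => //.
  - by apply/measurable_EFinP; exact: measurableT_comp.
  - by move=> w _; apply: sume_ge0 => j _; rewrite adde_ge0 ?lee_fin// integral_ge0.
  - by apply: emeasurable_sum => j; exact: emeasurable_funD.
rewrite ge0_integral_sum//; last 2 first.
- by move=> j; exact: emeasurable_funD.
- by move=> j w _; rewrite adde_ge0 ?lee_fin// integral_ge0.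
rewrite (_ : n%:R * (2 * eps) = \sum_(j < n) (eps + eps)); last first.
  by rewrite sumr_const card_ord mulr_natl; congr (_ *+ _); lra.
rewrite -sumEFin; apply: lee_sum => j _.
rewrite ge0_integralD//; last by move=> w _; rewrite integral_ge0.
rewrite EFinD; apply: leeD.
  by rewrite (campbell_within intf (iidX.1 j) mgs (fun t _ => normr_ge0 _)).2.
rewrite (integral_cst P measurableT) -[leRHS]mule1.
by rewrite lee_wpmul2l ?lee_fin//; exact: probability_le1.
Qed.

End Deviation.

(** The moments of the deviation are bounded through those of step functions.
    Truncation at [M] makes [x ^+ (2 * s)] Lipschitz, so that the first-order
    approximation of [integral_deviation_step] is enough; [M] then goes to
    infinity. *)
Lemma total_deviation_moment (s : nat) : exists2 C : R, 0 <= C &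
  forall (n : nat) d (Omega : measurableType d) (P : probability Omega R)
    (X : 'I_n -> Omega -> {measure set (measurableTypeR R) -> \bar R}),
    (1 <= n)%N -> iid_poisson_processes P T f X ->
    (\int[P]_w (total_deviation X w ^+ (2 * s))%:E <= (C * n%:R ^+ s)%:E)%E.
Proof.
pose m q := fine (weighted_integral T f (fun t => `|g t| ^+ q)%R).
have mgq q : measurable_fun [set` T] (fun t => `|g t| ^+ q).
  by apply: measurable_funX; exact: measurableT_comp.
have m_ge0 q : 0 <= m q.
  by apply: fine_ge0; apply: (weighted_integral_ge0 intf) => t _; rewrite exprn_ge0.
have mE q : (0 < q)%N -> weighted_integral T f (fun t => `|g t| ^+ q)%R = (m q)%:E.
  move=> q0; rewrite /m fineK// ge0_fin_numE; first exact: gfin.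
  by apply: (weighted_integral_ge0 intf) => t _; rewrite exprn_ge0.
(* A bound for all the moments of [g] up to [2 s], and, by the extra [1], for
   those of its step approximations. *)
pose B := 1 + \sum_(q < (2 * s).+1) m q.
have mB q : (q <= 2 * s)%N -> m q + 1 <= B.
  move=> qs; rewrite addrC lerD2l (bigD1 (Ordinal (qs : (q < (2 * s).+1)%N)))//=.
  by rewrite lerDl sumr_ge0.
have B1 : 1 <= B by rewrite lerDl sumr_ge0.
have B0 : 0 <= B by exact: le_trans B1.
pose C0 := B ^+ (2 * s) * 2 ^+ ((2 * s) ^ 2).
have C00 : 0 <= C0 by rewrite mulr_ge0 ?exprn_ge0.
exists (C0 + 1) => [|n d Omega P X n1 iidX]; first by rewrite addr_ge0.
have n1R : 1 <= n%:R ^+ s :> R by rewrite exprn_ege1// ler1n.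
have mZ := measurable_total_deviation iidX.
pose Z := total_deviation X.
have truncated (M : nat) :
    (\int[P]_w (Num.min `|Z w| M%:R ^+ (2 * s))%:E <= ((C0 + 1) * n%:R ^+ s)%:E)%E.
  (* [K] is the Lipschitz constant of the truncated power; [eps] is chosen so
     that the approximation changes the moment by at most [1 <= n ^ s]. *)
  pose K : R := (2 * s)%:R * M%:R ^+ (2 * s).-1.
  have K0 : 0 <= K by rewrite mulr_ge0// exprn_ge0.
  pose eps := ((K + 1) * (n%:R * 2))^-1.
  have n0 : 0 < n%:R :> R by rewrite ltr0n.
  have eps0 : 0 < eps by rewrite invr_gt0 !mulr_gt0// ltr_wpDl.
  have [l [J [c [TJ dJ geps hq]]]] := step_approximation (2 * s) intf mg gfin1 eps0.
  have {}hq q : (0 < q <= 2 * s)%N ->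
      \sum_(i < l) `|c i| ^+ q * \int[mu]_(t in [set` J i]) f t <= B.
    move=> /andP[q0 qs]; have := hq q qs.
    rewrite -/(step J c) (weighted_integral_step c TJ dJ q0) mE// -EFinD lee_fin.
    by move=> /le_trans; apply; exact: mB.
  have sysN := poisson_system_counts iidX TJ dJ f0.
  pose S w := centred_sum (fun a => \int[mu]_(t in [set` J a.2]) f t)
    (fun a => c a.2) (counts X J w).
  have mS : measurable_fun setT S := poisson_system_measurable sysN _.
  have S2 : (\int[P]_w (S w ^+ (2 * s))%:E <= (C0 * n%:R ^+ s)%:E)%E.
    have iS := integrable_centred_sum sysN (fun a => c a.2) (2 * s).
    rewrite -[leLHS]fineK ?lee_fin; last exact: integrable_fin_num iS.
    have := centred_moment_bound sysN (c := fun a => c a.2) B1 n1 (s := (2 * s)%N).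
    rewrite mul2n doubleK -mul2n => /(_ _)/(le_trans (ler_norm _)); apply.
    move=> q /andP[q2 qs].
    rewrite (le_trans (ler_norm_sum _ _ _))//.
    rewrite [leLHS](_ : _ = n%:R *
        \sum_(i < l) `|c i| ^+ q * \int[mu]_(t in [set` J i]) f t).
      by rewrite ler_wpM2l//; apply: hq; rewrite qs (ltnW q2).
    transitivity (\sum_(j < n) \sum_(i < l)
        `|c i| ^+ q * \int[mu]_(t in [set` J i]) f t).
      rewrite pair_bigA/=; apply: eq_bigr => -[j i] _ /=.
      by rewrite normrM normrX mulrC (ger0_norm (sysN.1 (j, i))).
    by rewrite sumr_const card_ord mulr_natl.
  have dev := integral_deviation_step iidX TJ dJ (ltW eps0) geps.
  have mZS : measurable_fun setT (fun w => `|Z w - S w|).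
    by apply: measurableT_comp => //; exact: measurable_funB.
  have mSs : measurable_fun setT (fun w => S w ^+ (2 * s)) by exact: measurable_funX.
  have S2pos w : 0 <= S w ^+ (2 * s) by rewrite exprM exprn_ge0// sqr_ge0.
  apply: (@le_trans _ _ (\int[P]_w ((S w ^+ (2 * s))%:E + K%:E * `|Z w - S w|%:E))%E).
    apply: ge0_le_integral => //.
    - apply/measurable_EFinP; apply: measurable_funX; apply: measurable_minr => //.
      exact: measurableT_comp.
    - apply: emeasurable_funD; first exact/measurable_EFinP.
      by apply: measurable_funeM; exact/measurable_EFinP.
    - move=> w _; rewrite -EFinM -EFinD lee_fin.
      have minM (x : R) : `|Num.min `|x| M%:R| <= M%:R :> R.
        by rewrite ger0_norm ?le_min ?normr_ge0//= ge_min lexx orbT.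
      have := exprn_lipschitz (2 * s) (minM (Z w)) (minM (S w)).
      move=> /(le_trans (ler_norm _)); rewrite lerBlDl => /le_trans; apply.
      rewrite lerD//.
        rewrite -[leRHS]ger0_norm// normrX lerXn2r ?nnegrE ?le_min ?normr_ge0//=.
        by rewrite ge_min lexx.
      rewrite ler_wpM2l//.
      apply: le_trans (ler_dist_dist _ _).
      exact: ler_dist_min.
  rewrite ge0_integralD//; last 4 first.
  - by move=> w _; rewrite lee_fin.
  - exact/measurable_EFinP.
  - by move=> w _; rewrite mule_ge0// lee_fin.
  - by apply: measurable_funeM; exact/measurable_EFinP.
  rewrite mulrDl EFinD; apply: leeD => //.
  rewrite ge0_integralZl_EFin//; last exact/measurable_EFinP.
  apply: (@le_trans _ _ (K%:E * (n%:R * (2 * eps))%:E)%E).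
    by rewrite lee_wpmul2l// lee_fin.
  rewrite -EFinM lee_fin mul1r (le_trans _ n1R)//.
  rewrite (@le_trans _ _ ((K + 1) * (n%:R * (2 * eps))))//.
    by rewrite ler_wpM2r ?lerDl// !mulr_ge0// ltW.
  by rewrite !mulrA -[_ * 2]mulrA mulfV// mulf_neq0 ?mulf_neq0 ?gt_eqF// ltr_wpDl.
have Zlim w : (Z w ^+ (2 * s))%:E = limn (fun M => (Num.min `|Z w| M%:R ^+ (2 * s))%:E).
  apply/esym/cvg_lim => //; apply: cvg_near_cst; near=> M.
  rewrite min_l.
    by rewrite -normrX ger0_norm// exprM exprn_ge0// sqr_ge0.
  have /andP[_ /ltW/le_trans] := truncn_itv (normr_ge0 (Z w)); apply.
  by rewrite ler_nat; near: M; exists (Num.truncn `|Z w|).+1.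
under eq_integral do rewrite -/(Z _) Zlim.
rewrite monotone_convergence//.
- apply: lime_le; last by apply: nearW => M; exact: truncated.
  apply: ereal_nondecreasing_is_cvgn => i j ij; apply: ge0_le_integral => //.
  + apply/measurable_EFinP; apply: measurable_funX; apply: measurable_minr => //.
    exact: measurableT_comp.
  + apply/measurable_EFinP; apply: measurable_funX; apply: measurable_minr => //.
    exact: measurableT_comp.
  + move=> w _; rewrite lee_fin lerXn2r ?nnegrE ?le_min ?normr_ge0//=.
    by rewrite ge_min lexx/= ge_min ler_nat ij orbT.
- move=> M; apply/measurable_EFinP; apply: measurable_funX; apply: measurable_minr => //.
  exact: measurableT_comp.
- move=> w _ i j ij; rewrite lee_fin lerXn2r ?nnegrE ?le_min ?normr_ge0//=.
  by rewrite ge_min lexx/= ge_min ler_nat ij orbT.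
Unshelve. all: by end_near. Qed.

End EmpiricalMomentBound.

(** * Derivatives of the inverse function and Taylor expansion *)

(** The mean value theorem; for [1 < p] the derivative [p * x ^ (p - 1)] is
    bounded near [0]. *)
Lemma powR_lipschitz (R : realType) (p M u v : R) : 1 < p ->
  0 <= u <= M -> 0 <= v <= M ->
  `|u `^ p - v `^ p| <= p * M `^ (p - 1) * `|u - v|.
Proof.
move=> p1; wlog vu : u v / v <= u => [hw uM vM|].
  have [/hw|/ltW /hw] := leP v u; first exact.
  by rewrite distrC [X in _ <= _ * X]distrC; exact.
move=> /andP[u0 uM] /andP[v0 vM].
have p0 : 0 <= p by exact: ltW (lt_trans _ p1).
have p10 : 0 <= p - 1 by rewrite subr_ge0 ltW.
have M0 : 0 <= M by exact: le_trans uM.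
have uv : v `^ p <= u `^ p by rewrite ge0_ler_powR// nnegrE.
rewrite !ger0_norm ?subr_ge0//.
have [v_eq0|v_neq0] := eqVneq v 0.
  rewrite v_eq0 powR0 ?gt_eqF ?(lt_trans _ p1)// !subr0.
  rewrite -(mulr_powRB1 u0 (lt_trans ltr01 p1)) mulrC ler_wpM2r//.
  apply: (@le_trans _ _ (1 * M `^ (p - 1))).
    by rewrite mul1r ge0_ler_powR// nnegrE.
  by rewrite ler_wpM2r ?powR_ge0// ltW.
have v_gt0 : 0 < v by rewrite lt_neqAle eq_sym v_neq0.
have dpow x : x \in `[v, u] -> is_derive x 1 (fun y : R => y `^ p) (p * x `^ (p - 1)).
  rewrite in_itv/= => /andP[vx _]; apply: is_derive1_powR.
  exact: lt_le_trans vx.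
have cpow : {within `[v, u], continuous (fun y : R => y `^ p)}.
  apply: derivable_within_continuous => y yvu.
  by have [] := dpow y yvu.
have dpow' x : x \in `]v, u[ -> is_derive x 1 (fun y : R => y `^ p) (p * x `^ (p - 1)).
  by move=> xvu; apply: dpow; exact: subset_itv_oo_cc.
have [c cvu powE] := MVT_segment vu dpow' cpow.
rewrite powE ler_wpM2r ?subr_ge0// ler_wpM2l//.
move: cvu; rewrite in_itv/= => /andP[vc cu].
apply: (ge0_ler_powR p10); rewrite ?nnegrE//; first exact: le_trans vc.
exact: le_trans uM.
Qed.

Section Smooth.
Context (R : realType) (a b : R).
Let I x := x \in `]a, b[.

(** [smooth j f]: on [`]a, b[] the derivatives of [f] of order less than [j] are
    differentiable.  Stated recursively from the first derivative, which is the
    form that the product rule iterates. *)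
Fixpoint smooth (j : nat) (f : R -> R) : Prop :=
  if j is i.+1 then (forall x, I x -> derivable f x 1) /\ smooth i (derive1 f)
  else True.

Lemma near_interval x : I x -> \forall y \near x, I y.
Proof. by move=> Ix; exact: near_in_itvoo. Qed.

Lemma eq_derive1_interval (f g : R -> R) : (forall x, I x -> f x = g x) ->
  forall x, I x -> derive1 f x = derive1 g x.
Proof.
move=> fg x Ix; rewrite !derive1E; apply: near_eq_derive.
by apply: filterS (near_interval Ix) => y; exact: fg.
Qed.

Lemma eq_smooth j (f g : R -> R) : (forall x, I x -> f x = g x) ->
  smooth j f -> smooth j g.
Proof.
elim: j f g => //= j ih f g fg [df sf]; split.
  move=> x Ix; apply: near_eq_derivable (df x Ix).
  by apply: filterS (near_interval Ix) => y; exact: fg.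
by apply: ih sf; exact: eq_derive1_interval.
Qed.

Lemma smoothW i j (f : R -> R) : (i <= j)%N -> smooth j f -> smooth i f.
Proof.
elim: i j f => //= i ih [|j]//= f; rewrite ltnS => ij [df sf]; split=> //.
exact: ih sf.
Qed.

Lemma smooth_cst j (c : R) : smooth j (cst c).
Proof.
elim: j c => //= j ih c; split=> [x _|]; first exact: derivable_cst.
rewrite (_ : derive1 _ = cst 0)//; apply/funext => x.
by rewrite derive1_cst.
Qed.

Lemma smoothD j (f g : R -> R) : smooth j f -> smooth j g ->
  smooth j (fun x => f x + g x).
Proof.
elim: j f g => //= j ih f g [df sf] [dg sg]; split.
  by move=> x Ix; apply: derivableD; [exact: df|exact: dg].
apply: (@eq_smooth _ (fun x => derive1 f x + derive1 g x)); last exact: ih.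
by move=> x Ix; rewrite !derive1E deriveD//; [exact: df|exact: dg].
Qed.

Lemma smoothM j (f g : R -> R) : smooth j f -> smooth j g ->
  smooth j (fun x => f x * g x).
Proof.
elim: j f g => //= j ih f g [df sf] [dg sg]; split.
  by move=> x Ix; apply: derivableM; [exact: df|exact: dg].
apply: (@eq_smooth _ (fun x => derive1 f x * g x + f x * derive1 g x)).
  move=> x Ix; rewrite !derive1E deriveM//; [|exact: df|exact: dg].
  by rewrite addrC [_ *: 'D_1 f x]mulrC.
apply: smoothD; apply: ih => //.
  exact: (smoothW (leqnSn j) (conj dg sg)).
exact: (smoothW (leqnSn j) (conj df sf)).
Qed.

Lemma smoothV j (f : R -> R) : (forall x, I x -> f x != 0) -> smooth j f ->
  smooth j (fun x => (f x)^-1).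
Proof.
move=> f0; elim: j => //= j ih [df sf]; split.
  by move=> x Ix; apply: derivableV; [exact: f0|exact: df].
apply: (@eq_smooth _ (fun x => (-1 * derive1 f x) * ((f x)^-1 * (f x)^-1))).
  move=> x Ix; rewrite !derive1E deriveV//; [|exact: f0|exact: df].
  by rewrite mulN1r -[RHS]mulrC mulrN -mulNr expr2 invfM.
have sV : smooth j (fun x => (f x)^-1).
  by apply: ih; exact: (smoothW (leqnSn j) (conj df sf)).
by apply: smoothM; apply: smoothM => //; exact: smooth_cst.
Qed.

Lemma smooth_derive1n j (f : R -> R) :
  (forall l x, (l < j)%N -> I x -> derivable (derive1n l f) x 1) -> smooth j f.
Proof.
elim: j f => //= j ih f df; split; first by move=> x; exact: (df 0%N).
by apply: ih => l x lj Ix; rewrite -derive1Sn; exact: df.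
Qed.

Lemma smooth_derivable j (f : R -> R) x : (0 < j)%N -> smooth j f -> I x ->
  derivable f x 1.
Proof. by case: j => //= j _ [df _]; exact: df. Qed.

End Smooth.

Section InverseDerivatives.
Context (R : realType) (a b : R) (m G : R -> R) (k : nat).
Let I x := x \in `]a, b[.
Hypothesis sm : smooth a b k.+1 m.
Hypothesis m'0 : forall x, I x -> derive1 m x != 0.
Hypothesis Gm : forall x, I x -> G (m x) = x.
Hypothesis m_open : forall x, I x -> \forall y \near m x, exists2 z, I z & m z = y.

(** The derivative of order [l] of [G] at [m x], as a function of [x]: by the
    chain rule each derivative in the variable [m x] divides by [m' x]. *)
Fixpoint inverse_derivative (l : nat) : R -> R :=
  if l is i.+1 then fun x => derive1 (inverse_derivative i) x * (derive1 m x)^-1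
  else id.

Lemma smooth_inverse_derivative l : (l <= k)%N ->
  smooth a b (k.+1 - l) (inverse_derivative l).
Proof.
elim: l => [_|l ih lk] /=.
  split=> [x _|]; first exact: derivable_id.
  rewrite (_ : derive1 id = cst 1); first exact: smooth_cst.
  by apply/funext => y; rewrite derive1_id.
have {}ih := ih (ltnW lk).
rewrite subSS; apply: smoothM.
  by move: ih; rewrite subSn ?(ltnW lk)//= => -[].
apply: smoothV => //; apply: smoothW (leq_subr l k) _.
by case: sm.
Qed.

Lemma is_derive_inverse_at x : I x -> is_derive (m x) 1 G (derive1 m x)^-1.
Proof.
move=> Ix.
have dm y : I y -> derivable m y 1 by case: sm => + _; apply.
apply: is_derive_inverse; last exact: m'0.
- by apply: filterS (near_interval Ix) => y; exact: Gm.
- apply: filterS (near_interval Ix) => y /dm /derivable1_diffP.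
  exact: differentiable_continuous.
- by rewrite derive1E; apply: DeriveDef => //; exact: dm.
Qed.

(** Differentiate [derive1n l G (m x) = inverse_derivative l x] along [G]: by
    [m_open] this identity describes [derive1n l G] in a neighbourhood of [m x]. *)
Lemma derive1n_inverse l : (l <= k)%N -> forall x, I x ->
  derive1n l G (m x) = inverse_derivative l x /\ derivable (derive1n l G) (m x) 1.
Proof.
elim: l => [_|l ih lk] x Ix.
  by split; [exact: Gm|have [] := is_derive_inverse_at Ix].
have step i : (i <= k)%N -> (forall x, I x -> derive1n i G (m x) = inverse_derivative i x) ->
    forall y, I y -> is_derive (m y) 1 (derive1n i G) (inverse_derivative i.+1 y).
  move=> ik hi y Iy; apply: (@near_eq_is_derive _ _ _ (inverse_derivative i \o G)).
    by apply: filterS (m_open Iy) => _ [z Iz <-] /=; rewrite Gm// hi.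
  apply: is_derive1_comp; last exact: is_derive_inverse_at.
  rewrite Gm// derive1E; apply: DeriveDef => //.
  by apply: smooth_derivable (smooth_inverse_derivative ik) Iy; rewrite subn_gt0 ltnS.
have hl y (Iy : I y) := (ih (ltnW lk) y Iy).1.
have hl1 y : I y -> derive1n l.+1 G (m y) = inverse_derivative l.+1 y.
  by move=> Iy; rewrite derive1nS derive1E; have [_ ->] := step l (ltnW lk) hl y Iy.
by split; [exact: hl1|have [] := step l.+1 lk hl1 x Ix].
Qed.

End InverseDerivatives.

Lemma is_derive_taylor (R : realType) (c : nat -> R) (x0 x : R) (j : nat) :
  is_derive x 1 (fun y => \sum_(l < j.+2) c l * (y - x0) ^+ l)
    (\sum_(l < j.+1) c l.+1 * l.+1%:R * (x - x0) ^+ l).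
Proof.
rewrite (_ : (fun y => _) = \sum_(l < j.+2) (fun y => c l * (y - x0) ^+ l)); last first.
  by apply/funext => y; rewrite fct_sumE.
rewrite (_ : \sum_(l < j.+1) _ =
    \sum_(l < j.+2) c l * (l%:R * (x - x0) ^+ l.-1)); last first.
  rewrite [RHS]big_ord_recl/= mul0r mulr0 add0r.
  by apply: eq_bigr => l _; rewrite mulrA.
apply: is_derive_sum => l.
have -> : (fun y => c l * (y - x0) ^+ l) = c l *: ((id - cst x0) ^+ l : R -> R).
  by rewrite exprfctE.
apply: is_derive_eq.
by rewrite subr0 -[LHS]/(c l * (l%:R * (x - x0) ^+ l.-1 * 1)) mulr1.
Qed.

(** Taylor expansion with a remainder of order [j + 1], by induction on [j]
    through the mean value theorem applied to the remainder; the case [j = 0] is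
    differentiability at the single point [x0]. *)
Lemma taylor_expansion (R : realType) (x0 : R) (j : nat) (f : R -> R) :
  (forall l, (l < j)%N -> \forall x \near x0, derivable (derive1n l f) x 1) ->
  derivable (derive1n j f) x0 1 ->
  exists2 C : R, 0 <= C & \forall x \near x0,
    `|f x - \sum_(l < j.+1) derive1n l f x0 / l`!%:R * (x - x0) ^+ l| <=
    C * `|x - x0| ^+ j.+1.
Proof.
elim: j f => [|j ih] f near_der der.
  have : is_derive x0 1 f (derive1 f x0) by rewrite derive1E; exact: DeriveDef.
  move=> /is_derive1_caratheodory[g [fE gc _]].
  exists (`|g x0| + 1); first by rewrite addr_ge0.
  have : \forall x \near x0, `|g x0 - g x| <= 1.
    by have /cvgrPdist_le := gc; apply.
  apply: filterS => x gx; rewrite big_ord1 expr0 fact0 divr1 mulr1 fE normrM expr1.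
  rewrite ler_wpM2r//.
  have -> : g x = g x0 - (g x0 - g x) by rewrite opprB addrC subrK.
  by rewrite (le_trans (ler_normB _ _))// lerD2l.
have [||C C0 near_rem] := ih (derive1 f).
- by move=> l lj; apply: filterS (near_der l.+1 lj) => x; rewrite derive1Sn.
- by rewrite -derive1Sn.
exists C => //.
have near_f := near_der 0%N (ltn0Sn _).
pose rem x := f x - \sum_(l < j.+2) derive1n l f x0 / l`!%:R * (x - x0) ^+ l.
pose rem' x := derive1 f x -
  \sum_(l < j.+1) derive1n l (derive1 f) x0 / l`!%:R * (x - x0) ^+ l.
have rem_der x : derivable f x 1 -> is_derive x 1 rem (rem' x).
  move=> df; apply: is_deriveB; first by rewrite derive1E; exact: DeriveDef.
  have := is_derive_taylor (fun l => derive1n l f x0 / l`!%:R) x0 x j.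
  congr is_derive; apply: eq_bigr => l _; congr (_ * _).
  rewrite derive1Sn factS natrM invfM -mulrA; congr (_ * _).
  by rewrite mulrAC mulVf ?mul1r// pnatr_eq0.
have rem0 : rem x0 = 0.
  rewrite /rem big_ord_recl/= expr0 fact0 divr1 mulr1 big1 ?addr0 ?subrr// => l _.
  by rewrite expr0n/= mulr0.
have : \forall x \near x0, derivable f x 1 /\ `|rem' x| <= C * `|x - x0| ^+ j.+1.
  by near=> x; split; near: x.
move=> /nbhs_ballP[e /= e0 he].
apply/nbhs_ballP; exists e => //= x; rewrite /ball/= => xe.
rewrite -/(rem x).
have bound c : `|x0 - c| <= `|x0 - x| -> `|rem' c| <= C * `|x - x0| ^+ j.+1.
  move=> cx; have [_ /le_trans] := he c (le_lt_trans cx xe); apply.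
  by rewrite ler_wpM2l// lerXn2r ?nnegrE// -[leLHS]normrN opprB -[leRHS]normrN opprB.
have rem_is c : `|x0 - c| <= `|x0 - x| -> is_derive c 1 rem (rem' c).
  by move=> cx; apply: rem_der; have [] := he c (le_lt_trans cx xe).
rewrite -[rem x]subr0 -rem0 exprSr mulrA.
have [xx0|x0x] := leP x x0.
  have in_seg c : c \in `[x, x0] -> `|x0 - c| <= `|x0 - x|.
    rewrite in_itv/= => /andP[xc cx0].
    by rewrite !ger0_norm ?subr_ge0// lerD2l lerN2.
  have [||c cI remE] := @MVT_segment _ rem rem' _ _ xx0.
  + by move=> c cI; apply/rem_is/in_seg; exact: subset_itv_oo_cc.
  + apply: derivable_within_continuous => c cI.
    by have [] := rem_is c (in_seg c cI).
  + have x0xE : `|x0 - x| = `|x - x0| by exact: distrC.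
    by rewrite distrC remE normrM x0xE ler_wpM2r// bound// in_seg.
have in_seg c : c \in `[x0, x] -> `|x0 - c| <= `|x0 - x|.
  rewrite in_itv/= => /andP[x0c cx].
  by rewrite !ler0_norm ?subr_le0// ?(ltW x0x)// !opprB lerD2r.
have [||c cI remE] := @MVT_segment _ rem rem' _ _ (ltW x0x).
- by move=> c cI; apply/rem_is/in_seg; exact: subset_itv_oo_cc.
- apply: derivable_within_continuous => c cI.
  by have [] := rem_is c (in_seg c cI).
- by rewrite remE normrM ler_wpM2r// bound// in_seg.
Unshelve. all: by end_near. Qed.

(** * The method of moments estimator *)

Lemma monotone_bounded_ends (R : realType) (a b B : R) (m : R -> R) : a < b ->
  {in `]a, b[ &, {homo m : x y / x <= y}} \/
  {in `]a, b[ &, {homo m : x y / x <= y >-> y <= x}} ->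
  (forall x, x \in `]a, b[ -> `|m x| <= B) ->
  cvg (m x @[x --> a^'+]) /\ cvg (m x @[x --> b^'-]).
Proof.
move=> ab; have nondecr (h : R -> R) : {in `]a, b[ &, {homo h : x y / x <= y}} ->
    (forall x, x \in `]a, b[ -> `|h x| <= B) ->
    cvg (h x @[x --> a^'+]) /\ cvg (h x @[x --> b^'-]).
  move=> hm hB; split.
    apply: nondecreasing_at_right_is_cvgr.
      near=> c => x y xc yc; apply: hm.
        by apply: subset_itvl xc; rewrite bnd_simp; near: c; exact: nbhs_right_le.
      by apply: subset_itvl yc; rewrite bnd_simp; near: c; exact: nbhs_right_le.
    near=> c; exists (- B) => _ /= [x xc <-].
    have /hB : x \in `]a, b[.
      by apply: subset_itvl xc; rewrite bnd_simp; near: c; exact: nbhs_right_le.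
    by rewrite ler_norml => /andP[].
  apply: nondecreasing_at_left_is_cvgr.
    near=> c => x y xc yc; apply: hm.
      by apply: subset_itvr xc; rewrite bnd_simp; near: c; exact: nbhs_left_ge.
    by apply: subset_itvr yc; rewrite bnd_simp; near: c; exact: nbhs_left_ge.
  near=> c; exists B => _ /= [x xc <-].
  have /hB : x \in `]a, b[.
    by apply: subset_itvr xc; rewrite bnd_simp; near: c; exact: nbhs_left_ge.
  by rewrite ler_norml => /andP[].
case=> [/nondecr|hm hB]; first exact.
have [||c1 c2] := nondecr (fun x => - m x).
- by move=> x y xI yI xy; rewrite lerN2; exact: hm.
- by move=> x xI; rewrite normrN; exact: hB.
by split; rewrite -is_cvgNE; [exact: c1|exact: c2].
Unshelve. all: by end_near. Qed.

Section MethodOfMoments.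
Context (R : realType) (alpha beta : R) (m : R -> R) (k : nat).
Hypothesis alpha_lt_beta : alpha < beta.
Hypothesis hL1 : condition_L1 alpha beta m k.
Hypothesis hL2 : condition_L2 alpha beta m.
Let I x := x \in `]alpha, beta[.
Let J x := x \in `[alpha, beta].
Let mbar := endpoint_extension alpha beta m.
Let G := inverse_moment alpha beta m.

Let IJ x : I x -> J x. Proof. exact: subset_itv_oo_cc. Qed.

Let dm x : I x -> derivable m x 1.
Proof. by case: hL1 => + _; move=> /(_ 0%N x (ltn0Sn _)). Qed.

Let ism x : I x -> is_derive x 1 m (derive1 m x).
Proof. by move=> Ix; rewrite derive1E; apply: DeriveDef => //; exact: dm. Qed.

Lemma derive1_moment_neq0 x : I x -> derive1 m x != 0.
Proof.
move=> Ix; case: hL2 => _ inf0; apply/eqP => m0.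
move: inf0; apply/negP; rewrite -leNgt.
apply: ge_inf; last by exists x => //; rewrite m0 normr0.
by exists 0 => _ [y _ <-].
Qed.

Lemma endpoint_extension_inside x : I x -> mbar x = m x.
Proof.
by rewrite /I in_itv/= /mbar /endpoint_extension => /andP[/lt_geF-> /lt_geF->].
Qed.

Lemma near_endpoint_extension x : I x -> \forall y \near x, m y = mbar y.
Proof.
move=> Ix; apply: filterS (near_interval Ix) => y Iy.
exact/esym/endpoint_extension_inside.
Qed.

Let ismbar x : I x -> is_derive x 1 mbar (derive1 m x).
Proof. by move=> Ix; apply: near_eq_is_derive (near_endpoint_extension Ix) (ism Ix). Qed.

(** The derivative is bounded and the interval is bounded; with monotonicity this
    gives the limits at the endpoints. *)
Lemma moment_bounded : exists B, forall x, I x -> `|m x| <= B.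
Proof.
have [_ hb] := hL1; have [_ [M hM]] := hb 1%N (ltn0Sn _).
have M0 : 0 <= M.
  have mid : (alpha + beta) / 2 \in `]alpha, beta[ by exact: mid_in_itvoo.
  exact: le_trans (hM _ mid).
pose x0 := (alpha + beta) / 2.
have Ix0 : I x0 by exact: mid_in_itvoo.
exists (`|m x0| + M * (beta - alpha)) => x Ix.
have lip u v : I u -> I v -> u <= v -> `|m v - m u| <= M * (beta - alpha).
  move=> Iu Iv uv.
  have sub c : c \in `[u, v] -> I c.
    move: Iu Iv; rewrite /I !in_itv/= => /andP[au _] /andP[_ vb] /andP[uc cv].
    by rewrite (lt_le_trans au uc) (le_lt_trans cv vb).
  have der c : c \in `]u, v[ -> is_derive c 1 m (derive1 m c).
    by move=> cuv; apply/ism/sub; exact: subset_itv_oo_cc.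
  have cont : {within `[u, v], continuous m}.
    by apply: derivable_within_continuous => c /sub /dm.
  have [c cuv ->] := MVT_segment uv der cont.
  rewrite normrM ler_pM//; first exact: hM (sub _ cuv).
  rewrite ger0_norm ?subr_ge0//.
  move: Iu Iv; rewrite /I !in_itv/= => /andP[/ltW au _] /andP[_ /ltW vb].
  by rewrite lerB.
rewrite -[m x](subrK (m x0)) addrC (le_trans (ler_normD _ _))// lerD2l.
have [xx0|/ltW x0x] := leP x x0; last exact: lip.
by rewrite distrC lip.
Qed.

Lemma endpoint_extension_continuous : {within `[alpha, beta], continuous mbar}.
Proof.
have [B mB] := moment_bounded; have [mon _] := hL2.
have [ca cb] := monotone_bounded_ends alpha_lt_beta mon mB.
apply/(continuous_within_itvP _ alpha_lt_beta); split.
- move=> x Ix; apply: differentiable_continuous; apply/derivable1_diffP.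
  by have [] := ismbar Ix.
- have -> : mbar alpha = lim (m x @[x --> alpha^'+]).
    by rewrite /mbar /endpoint_extension lexx.
  apply: cvg_trans ca; apply: near_eq_cvg; near=> x.
  apply/esym/endpoint_extension_inside; rewrite /I in_itv/=; apply/andP; split.
    by near: x; exact: nbhs_right_gt.
  by near: x; exact: nbhs_right_lt.
- have -> : mbar beta = lim (m x @[x --> beta^'-]).
    by rewrite /mbar /endpoint_extension lexx leNgt alpha_lt_beta.
  apply: cvg_trans cb; apply: near_eq_cvg; near=> x.
  apply/esym/endpoint_extension_inside; rewrite /I in_itv/=; apply/andP; split.
    by near: x; exact: nbhs_left_gt.
  by near: x; exact: nbhs_left_lt.
Unshelve. all: by end_near. Qed.

(** The mean value theorem, with a derivative that vanishes nowhere inside. *)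
Lemma endpoint_extension_inj : {in `[alpha, beta] &, injective mbar}.
Proof.
have lt_neq u v : J u -> J v -> u < v -> mbar u <> mbar v.
  rewrite /J !in_itv/= => /andP[au _] /andP[_ vb] uv muv.
  have sub c : c \in `]u, v[ -> I c.
    rewrite /I !in_itv/= => /andP[uc cv].
    by rewrite (le_lt_trans au uc) (lt_le_trans cv vb).
  have der c : c \in `]u, v[ -> is_derive c 1 mbar (derive1 m c).
    by move=> cuv; apply/ismbar/sub.
  have cont : {within `[u, v], continuous mbar}.
    apply: continuous_subspaceW endpoint_extension_continuous.
    move=> x; rewrite /= !in_itv/= => /andP[ux xv].
    by rewrite (le_trans au ux) (le_trans xv vb).
  have [c cuv /eqP] := MVT uv der cont.
  rewrite muv subrr eq_sym mulf_eq0 (negbTE (derive1_moment_neq0 (sub _ cuv)))/=.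
  by rewrite subr_eq0 gt_eqF.
move=> u v Ju Jv muv; apply: contrapT => /eqP; rewrite neq_lt => /orP[uv|vu].
  exact: lt_neq muv.
exact: (lt_neq v u) (esym muv).
Qed.

Lemma inverse_momentK x : J x -> G (mbar x) = x.
Proof.
move=> Jx; have inj : {in [set` `[alpha, beta]] &, injective mbar}.
  by move=> u v; rewrite !inE; exact: endpoint_extension_inj.
by apply: (pinvKV _ inj); rewrite inE.
Qed.

Lemma mme_exists y : exists2 x, J x & forall x', J x' ->
  (mbar x - y) ^+ 2 <= (mbar x' - y) ^+ 2.
Proof.
apply: (@EVT_min _ (fun x => (mbar x - y) ^+ 2)); first exact: ltW.
have cB : {within `[alpha, beta], continuous (fun x => mbar x - y)}.
  move=> x; apply: continuousB; last exact: cst_continuous.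
  exact: endpoint_extension_continuous.
move=> x; apply: (@continuous_comp (subspace `[alpha, beta]) R R
  (fun x => mbar x - y) (fun z => z ^+ 2)); first exact: cB.
exact: exprn_continuous.
Qed.

Lemma mmeP y : J (mme alpha beta m y) /\ forall x', J x' ->
  (mbar (mme alpha beta m y) - y) ^+ 2 <= (mbar x' - y) ^+ 2.
Proof.
rewrite /mme; case: xgetP => [x _ [Jx hx]//|noex].
by have [x Jx hx] := mme_exists y; case: (noex x).
Qed.

Lemma mme_moment x : J x -> mme alpha beta m (mbar x) = x.
Proof.
move=> Jx; have [Jm /(_ x Jx)] := mmeP (mbar x).
rewrite subrr expr0n/= => h; apply: endpoint_extension_inj => //.
by apply/eqP; rewrite -subr_eq0 -sqrf_eq0 eq_le h sqr_ge0.
Qed.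

(** The estimator is monotone in the data: if two minimizers were in the wrong
    order, comparing the two squared distances to each data point would put the
    data points in the wrong order as well. *)
Lemma measurable_mme : measurable_fun setT (mme alpha beta m).
Proof.
have lt_min x1 x2 y1 y2 : (x1 - y1) ^+ 2 <= (x2 - y1) ^+ 2 ->
    (x2 - y2) ^+ 2 <= (x1 - y2) ^+ 2 -> x2 < x1 -> y2 <= y1 :> R.
  by rewrite !expr2; nra.
case: (itv_continuous_inj_mono endpoint_extension_continuous endpoint_extension_inj)
  => mono.
  apply: nondecreasing_measurable; first exact: measurableT.
  move=> y1 y2 y12.
  move: y12; rewrite le_eqVlt => /predU1P[->//|y12].
  rewrite leNgt; apply/negP => x21.
  have [J1 h1] := mmeP y1; have [J2 h2] := mmeP y2.
  have := lt_min _ _ _ _ (h1 _ J2) (h2 _ J1) (mono _ _ J2 J1 x21).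
  by rewrite leNgt y12.
apply: nonincreasing_measurable; first exact: measurableT.
move=> y1 y2 y12.
move: y12; rewrite le_eqVlt => /predU1P[->//|y12].
rewrite leNgt; apply/negP => x12.
have [J1 h1] := mmeP y1; have [J2 h2] := mmeP y2.
have := lt_min _ _ _ _ (h1 _ J2) (h2 _ J1) (mono _ _ J2 J1 x12).
by rewrite leNgt y12.
Qed.

(** The intermediate value theorem on a compact interval around [x]. *)
Lemma moment_open x : I x -> \forall y \near m x, exists2 z, I z & m z = y.
Proof.
move=> Ix; have : I x by []. rewrite {1}/I in_itv/= => /andP[ax xb].
pose u := (alpha + x) / 2; pose v := (x + beta) / 2.
have Iu : I u by rewrite /I in_itv/= /u; apply/andP; split; lra.
have Iv : I v by rewrite /I in_itv/= /v; apply/andP; split; lra.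
have ux : u < x by rewrite /u; lra.
have xv : x < v by rewrite /v; lra.
have uv := lt_trans ux xv.
have sub z : z \in `[u, v] -> I z.
  move: Iu Iv; rewrite /I !in_itv/= => /andP[au _] /andP[_ vb] /andP[uz zv].
  by rewrite (lt_le_trans au uz) (le_lt_trans zv vb).
have cont : {within `[u, v], continuous m}.
  by apply: derivable_within_continuous => c /sub /dm.
have ivt y : Num.min (m u) (m v) <= y <= Num.max (m u) (m v) ->
    exists2 z, I z & m z = y.
  by move=> /(IVT (ltW uv) cont)[z /sub Iz mz]; exists z.
have near_lt a b : a < m x -> m x < b -> \forall y \near m x, a <= y <= b.
  move=> am mb; near=> y; apply/andP; split; apply: ltW.
    by near: y; exact: lt_nbhsr.
  by near: y; exact: lt_nbhsl.
have [mono|mono] :=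
  itv_continuous_inj_mono endpoint_extension_continuous endpoint_extension_inj.
  have mux : m u < m x by rewrite -!endpoint_extension_inside// mono//; exact: IJ.
  have mxv : m x < m v by rewrite -!endpoint_extension_inside// mono//; exact: IJ.
  apply: filterS (near_lt _ _ mux mxv) => y yuv; apply: ivt.
  by rewrite min_l ?max_r// ltW// (lt_trans mux).
have mux : m x < m u by rewrite -!endpoint_extension_inside// mono//; exact: IJ.
have mxv : m v < m x by rewrite -!endpoint_extension_inside// mono//; exact: IJ.
apply: filterS (near_lt _ _ mxv mux) => y yuv; apply: ivt.
by rewrite min_r ?max_l// ltW// (lt_trans mxv).
Unshelve. all: by end_near. Qed.


Let sm : smooth alpha beta k.+2 m.
Proof. by apply: smooth_derive1n => l x lk Ix; case: hL1 => + _; apply. Qed.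

Let Gm x : I x -> G (m x) = x.
Proof. by move=> Ix; rewrite -endpoint_extension_inside// inverse_momentK//; exact: IJ. Qed.

Variable theta0 : R.
Hypothesis Itheta0 : I theta0.
Let Psi y := \sum_(1 <= l < k.+1) psi alpha beta m theta0 l * (y - m theta0) ^+ l.

(** The powers of [n] in [eta] cancel those of the definition of [Psi0]. *)
Lemma Psi0E n y : (0 < n)%N -> Psi0 alpha beta m theta0 k n y = Psi y.
Proof.
move=> n0; apply: eq_bigr => l _; rewrite /eta exprMn -mulrA; congr (_ * _).
rewrite mulrAC -[X in _ = X]mul1r; congr (_ * _).
have nn0 : 0 < n%:R :> R by rewrite ltr0n.
rewrite -powR12_sqrt ?ltW// -powR_mulrn ?powR_ge0// -powRrM -powRD; last first.
  by rewrite [n%:R == 0]gt_eqF// implybT.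
by rewrite [_ + _](_ : _ = 0) ?powRr0//; lra.
Qed.

(** Near [m theta0] the data lie in the range of [m], where the estimator is [G];
    [Psi] is the Taylor polynomial of [G] without its constant term [theta0]. *)
Lemma mme_taylor : exists2 C : R, 0 <= C & \forall y \near m theta0,
  `|mme alpha beta m y - theta0 - Psi y| <= C * `|y - m theta0| ^+ k.+1.
Proof.
have inv l := @derive1n_inverse R alpha beta m G k.+1 sm derive1_moment_neq0 Gm
  moment_open l.
have [l lk||C C0 taylorC] := @taylor_expansion R (m theta0) k G.
- apply: filterS (moment_open Itheta0) => _ [z Iz <-].
  by have [] := inv l (leq_trans (ltnW lk) (leqnSn k)) z Iz.
- by have [] := inv k (leqnSn k) theta0 Itheta0.
exists C => //; near=> y.
have [z Iz zy] : exists2 z, I z & m z = y.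
  by near: y; exact: moment_open.
have -> : mme alpha beta m y = G y.
  rewrite -zy Gm// -[in LHS]endpoint_extension_inside// mme_moment//; exact: IJ.
rewrite -addrA -opprD.
rewrite [X in G y - X](_ : _ =
    \sum_(l < k.+1) derive1n l G (m theta0) / l`!%:R * (y - m theta0) ^+ l).
  by near: y.
rewrite big_ord_recl/= Gm// divr1 expr0 mulr1; congr (_ + _).
by rewrite /Psi big_add1/= big_mkord; apply: eq_bigr.
Unshelve. all: by end_near. Qed.

Lemma mme_dist y : `|mme alpha beta m y - theta0| <= beta - alpha.
Proof.
have [Jm _] := mmeP y; move: Jm (IJ Itheta0); rewrite /J !in_itv/=.
move=> /andP[am mb] /andP[at0 t0b]; rewrite ler_norml; apply/andP; split; lra.
Qed.

(** Close to [m theta0] the difference of the [p]-th powers is controlled by the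
    Taylor remainder; away from it the estimator is bounded and the polynomial
    grows at most like a power of degree [k], so a high power of the deviation
    dominates everything. *)
Lemma mme_powR_expansion (p : R) (N : nat) : 1 < p -> k%:R * p <= (2 * N)%:R ->
  exists2 C : R, 0 <= C & forall y,
    `| `|mme alpha beta m y - theta0| `^ p - `|Psi y| `^ p | <=
    C * (`|y - m theta0| ^+ k.+1 + `|y - m theta0| ^+ (2 * N)).
Proof.
move=> p1 kpN; have p0 : 0 <= p by exact: le_trans (ltW p1).
have [C C0 /nbhs_ballP[e/= e0 hC]] := mme_taylor.
pose A := \sum_(1 <= l < k.+1) `|psi alpha beta m theta0 l|.
pose L := beta - alpha.
have A0 : 0 <= A by apply: sumr_ge0.
have L0 : 0 <= L by rewrite subr_ge0 ltW.
(* Where [dl <= u], the ratio [v = u / dl] is at least [1], so that its lower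
   powers are below its higher ones; [dl <= 1] ensures [u <= v]. *)
pose dl := Num.min e 1.
have dl0 : 0 < dl by rewrite lt_min e0 ltr01.
have dl1 : dl <= 1 by rewrite ge_min lexx orbT.
have Psi_bound y v : 1 <= v -> `|y - m theta0| <= v -> `|Psi y| <= A * v ^+ k.
  move=> v1 yv; rewrite /Psi /A mulr_suml (le_trans (ler_norm_sum _ _ _))//.
  rewrite !big_nat; apply: ler_sum => l /andP[_ lk].
  rewrite normrM normrX ler_wpM2l// (@le_trans _ _ (v ^+ l))//.
    by rewrite lerXn2r// nnegrE// (le_trans ler01).
  by rewrite ler_weXn2l.
pose M := L + A.
pose K1 := p * M `^ (p - 1) * C.
pose K2 := (L `^ p + A `^ p) * dl ^- (2 * N).
have K10 : 0 <= K1 by rewrite !mulr_ge0 ?powR_ge0.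
have K20 : 0 <= K2 by rewrite mulr_ge0 ?addr_ge0 ?powR_ge0// invr_ge0 exprn_ge0 ?ltW.
exists (K1 + K2); first exact: addr_ge0.
move=> y; set u := `|y - m theta0|.
have u0 : 0 <= u by exact: normr_ge0.
have uk0 : 0 <= u ^+ k.+1 by exact: exprn_ge0.
have uN0 : 0 <= u ^+ (2 * N) by exact: exprn_ge0.
rewrite mulrDr; have [u_small|u_big] := ltP u dl.
  have ye : ball (m theta0) e y.
    by rewrite /ball/= distrC (lt_le_trans u_small)// ge_min lexx.
  have yA : `|Psi y| <= A.
    rewrite -[A]mulr1 -(expr1n R k); apply: Psi_bound => //.
    exact: le_trans (ltW u_small) dl1.
  apply: (@le_trans _ _ (K1 * u ^+ k.+1)); last first.
    by rewrite -[leLHS]addr0 lerD// ?ler_wpM2r ?lerDl// mulr_ge0// addr_ge0.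
  have uM : 0 <= `|mme alpha beta m y - theta0| <= M.
    by rewrite normr_ge0 (le_trans (mme_dist y))// lerDl.
  have vM : 0 <= `|Psi y| <= M by rewrite normr_ge0 (le_trans yA)// lerDr.
  apply: le_trans (powR_lipschitz p1 uM vM) _.
  rewrite /K1 -!mulrA ler_wpM2l// ler_wpM2l ?powR_ge0//.
  exact: le_trans (ler_dist_dist _ _) (hC y ye).
pose v := u / dl.
have v1 : 1 <= v by rewrite ler_pdivlMr// mul1r.
have uv : u <= v by rewrite ler_pdivlMr// ler_piMr.
have vN : 1 <= v ^+ (2 * N) by exact: exprn_ege1.
have v0 : 0 <= v by exact: le_trans v1.
have vk0 : 0 <= A * v ^+ k by rewrite mulr_ge0// exprn_ge0.
have Psip : `|Psi y| `^ p <= A `^ p * v ^+ (2 * N).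
  apply: (@le_trans _ _ ((A * v ^+ k) `^ p)).
    by rewrite ge0_ler_powR// Psi_bound.
  rewrite powRM// ?exprn_ge0// ler_wpM2l ?powR_ge0//.
  by rewrite -!powR_mulrn// -powRrM ler_powR.
have mmep : `|mme alpha beta m y - theta0| `^ p <= L `^ p * v ^+ (2 * N).
  apply: (@le_trans _ _ (L `^ p)); last by rewrite ler_peMr ?powR_ge0.
  by rewrite ge0_ler_powR// ?nnegrE// mme_dist.
apply: (@le_trans _ _ (K2 * u ^+ (2 * N))); last first.
  rewrite -[leLHS]add0r lerD ?mulr_ge0 ?addr_ge0//.
  by rewrite ler_wpM2r// lerDr.
have -> : K2 * u ^+ (2 * N) = L `^ p * v ^+ (2 * N) + A `^ p * v ^+ (2 * N).
  by rewrite -mulrDl /K2 /v expr_div_n [u ^+ _ / _]mulrC mulrA.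
apply: le_trans (ler_normB _ _) _.
by apply: lerD; rewrite ger0_norm// powR_ge0.
Qed.

Lemma measurable_Psi0 n : measurable_fun setT (Psi0 alpha beta m theta0 k n).
Proof.
apply: measurable_sum => l.
apply: measurable_funM => //; apply: measurable_funM => //.
apply: measurable_funX; apply: measurable_funM => //.
exact: measurable_funB.
Qed.

End MethodOfMoments.

(** * Rate of convergence of the expected powers *)

(** [b] is integrable because [a] is bounded and [h] is integrable. *)
Lemma expectation_dist d (T : measurableType d) (R : realType)
    (P : probability T R) (a b h : T -> R) (A c : R) :
  measurable_fun setT a -> measurable_fun setT b -> measurable_fun setT h ->
  (forall w, `|a w| <= A) -> (forall w, `|a w - b w| <= h w) ->
  (\int[P]_w (h w)%:E <= c%:E)%E -> (`| 'E_P[a] - 'E_P[b] | <= c%:E)%E.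
Proof.
move=> ma mb mh aA abh hc; rewrite unlock.
have h0 w : 0 <= h w by exact: le_trans (abh w).
have ih : P.-integrable setT (EFin \o h).
  apply/integrableP; split; first exact/measurable_EFinP.
  apply: le_lt_trans (ltry c); apply: le_trans hc.
  by under eq_integral do rewrite /= ger0_norm//.
have ia : P.-integrable setT (EFin \o a).
  apply: (@le_integrable _ _ _ P setT measurableT _ (EFin \o cst A)) => //.
  - exact/measurable_EFinP.
  - by move=> w _ /=; rewrite lee_fin (le_trans (aA w))// ler_norm.
  - exact: finite_measure_integrable_cst.
have iab : P.-integrable setT (EFin \o (fun w => a w - b w)).
  apply: (@le_integrable _ _ _ P setT measurableT _ (EFin \o h)) => //.
  - by apply/measurable_EFinP; exact: measurable_funB.
  - by move=> w _ /=; rewrite lee_fin (le_trans (abh w))// ler_norm.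
have ib : P.-integrable setT (EFin \o b).
  apply: eq_integrable (integrableB measurableT ia iab) => //.
  by move=> w _ /=; rewrite -EFinB opprB addrC subrK.
have -> : (\int[P]_w (a w)%:E - \int[P]_w (b w)%:E = \int[P]_w (a w - b w)%:E)%E.
  by rewrite -integralB//.
apply: le_trans hc; apply: le_trans (le_abse_integral _ _ _) _ => //.
  by case/integrableP : iab.
apply: ge0_le_integral => //.
- by apply/measurable_EFinP/measurableT_comp => //; exact: measurable_funB.
- exact/measurable_EFinP.
- by move=> w _; rewrite lee_fin.
Qed.

(** With [x = S / sqrt n], of order one, [S / n = x / sqrt n]; the first power is
    made even by [x ^ j <= 1 + x ^ (2 j)]. *)
Lemma deviation_power_bound (R : realType) (n k N : nat) (S : R) :
  (0 < n)%N -> (k < 2 * N)%N ->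
  `|n%:R^-1 * S| ^+ k.+1 + `|n%:R^-1 * S| ^+ (2 * N) <=
  n%:R `^ (- ((2 * k + 1)%:R / 4)) *
  (1 + S ^+ (2 * k.+1) / n%:R ^+ k.+1 + S ^+ (2 * N) / n%:R ^+ N).
Proof.
have le_1DX2 (z : R) : z <= 1 + z ^+ 2.
  by have := sqr_ge0 (z - 1); have := sqr_ge0 z; rewrite !expr2; nra.
move=> n0 kN; set nu := _ `^ _.
have nn0 : 0 < n%:R :> R by rewrite ltr0n.
have n1 : 1 <= n%:R :> R by rewrite ler1n.
pose r : R := Num.sqrt n%:R.
have r0 : 0 < r by rewrite sqrtr_gt0.
have rr : r ^+ 2 = n%:R by rewrite sqr_sqrtr// ltW.
pose x := `|S| / r.
have x0 : 0 <= x by rewrite divr_ge0// ltW.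
have Sx : `|n%:R^-1 * S| = x / r.
  rewrite normrM normfV (ger0_norm (ltW nn0)) -rr expr2 invfM /x.
  by rewrite mulrC mulrA.
have Spow j : S ^+ (2 * j) / n%:R ^+ j = x ^+ (2 * j).
  rewrite exprM -real_normK ?num_real// -exprM -rr -exprM /x expr_div_n.
  by [].
have rnu j : (k < j)%N -> (r ^+ j)^-1 <= nu.
  move=> kj; rewrite -powR_mulrn ?(ltW r0)// /r -powR12_sqrt ?(ltW nn0)// -powRrM -powRN.
  rewrite /nu ler_powR// lerN2 natrD natrM.
  have : (k.+1)%:R <= j%:R :> R by rewrite ler_nat.
  by rewrite -natr1; lra.
have nu0 : 0 <= nu by exact: powR_ge0.
have le_nu j : (k < j)%N -> (x / r) ^+ j <= nu * x ^+ j.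
  by move=> kj; rewrite expr_div_n mulrC ler_wpM2r ?exprn_ge0// rnu.
rewrite !Spow Sx mulrDr lerD ?le_nu//.
apply: le_trans (le_nu _ (ltnSn k)) _; rewrite ler_wpM2l// mulnC exprM.
exact: le_1DX2.
Qed.

Lemma condition_L3_weighted (R : realType) (alpha beta : R) (T : interval R)
    (g : R -> R) (lambda : R -> R -> R) (theta : R) (q : nat) :
  condition_L3 alpha beta T g lambda -> theta \in `]alpha, beta[ -> (0 < q)%N ->
  (weighted_integral T (lambda theta) (fun t => `|g t| ^+ q)%R < +oo)%E.
Proof.
move=> L3 Ith q0; have q0R : 0 < q%:R :> R by rewrite ltr0n.
apply: le_lt_trans (L3 _ q0R); apply: ereal_sup_ubound; exists theta => //.
by apply: eq_integral => t _; rewrite powR_mulrn.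
Qed.

Theorem theorem2 (R : realType) (alpha beta : R) (T : interval R)
    (lambda : R -> R -> R) (g : R -> R) (k : nat) (theta0 p : R)
    (alpha_lt_beta : alpha < beta)
    (hlambda : forall theta, theta \in `]alpha, beta[ ->
       intensity T (lambda theta))
    (hg : measurable_fun [set` T] g)
    (hk : (1 <= k)%N)
    (hL1 : condition_L1 alpha beta (moment T g lambda) k)
    (hL2 : condition_L2 alpha beta (moment T g lambda))
    (hL3 : condition_L3 alpha beta T g lambda)
    (htheta0 : theta0 \in `]alpha, beta[)
    (hp : 1 < p) :
  exists Cstar : R, 0 < Cstar /\
    forall (n : nat), (1 <= n)%N ->
    forall (d : measure_display) (Omega : measurableType d)
      (P : probability Omega R)
      (X : 'I_n -> Omega -> {measure set (measurableTypeR R) -> \bar R}),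
      iid_poisson_processes P T (lambda theta0) X ->
      let m := moment T g lambda in
      let mn := empirical_moment T g X in
      (`| 'E_P[fun omega => (`|mme alpha beta m (mn omega) - theta0| `^ p)%R]
          - 'E_P[fun omega => (`|Psi0 alpha beta m theta0 k n (mn omega)| `^ p)%R] |
       <= (Cstar * n%:R `^ (- ((2 * k + 1)%:R / 4)))%:E)%E.
Proof.
pose m := moment T g lambda.
have intf := hlambda _ htheta0.
have gfin q (q0 : (0 < q)%N) := condition_L3_weighted hL3 htheta0 q0.
(* [2 N] must dominate the growth [k p] of the [p]-th power of the polynomial,
   and [n ^ (- N)] must be at most [n ^ (- (k + 1) / 2)]. *)
pose N := maxn k.+1 (Num.bound (k%:R * p)).
have kN : (k < 2 * N)%N by rewrite /N; lia.
have kpN : k%:R * p <= (2 * N)%:R.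
  have kp0 : 0 <= k%:R * p by rewrite mulr_ge0// (le_trans ler01)// ltW.
  apply: le_trans (ltW (archi_boundP kp0)) _; rewrite ler_nat /N.
  by rewrite (leq_trans (leq_maxr k.+1 _))// leq_pmull.
have [C C0 hC] := mme_powR_expansion alpha_lt_beta hL1 hL2 htheta0 hp kpN.
have [C1 C10 hC1] := total_deviation_moment intf hg gfin k.+1.
have [C2 C20 hC2] := total_deviation_moment intf hg gfin N.
exists (C * (1 + C1 + C2) + 1); split.
  by rewrite ltr_wpDl// mulr_ge0// !addr_ge0.
move=> n n1 d Omega P X iidX; lazy zeta; rewrite -/m.
set mn := empirical_moment T g X.
have nn0 : 0 < n%:R :> R by rewrite ltr0n.
pose S := total_deviation T (lambda theta0) g X.
have mS : measurable_fun setT S by exact: (measurable_total_deviation intf hg iidX).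
have mnE w : mn w - m theta0 = n%:R^-1 * S w by exact: empirical_momentE.
pose nu : R := n%:R `^ (- ((2 * k + 1)%:R / 4)).
have nu0 : 0 <= nu by exact: powR_ge0.
have mmn : measurable_fun setT mn.
  apply: measurable_funM => //; apply: measurable_sum => j.
  exact: (measurable_Rintegral_process intf (iidX.1 j)).
apply: (@expectation_dist _ _ _ _ _ _ (fun w => C * (nu *
    (1 + S w ^+ (2 * k.+1) / n%:R ^+ k.+1 + S w ^+ (2 * N) / n%:R ^+ N)))
    ((beta - alpha) `^ p)).
- apply: (measurableT_comp (measurable_powR p)); apply: measurableT_comp => //.
  apply: measurable_funB => //; apply: measurableT_comp mmn.
  exact: measurable_mme alpha_lt_beta hL1 hL2.
- apply: (measurableT_comp (measurable_powR p)); apply: measurableT_comp => //.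
  by apply: measurableT_comp mmn; exact: measurable_Psi0.
- apply: measurable_funM => //; apply: measurable_funM => //.
  apply: measurable_funD; first apply: measurable_funD => //.
    by apply: measurable_funM => //; exact: measurable_funX.
  by apply: measurable_funM => //; exact: measurable_funX.
- move=> w; rewrite ger0_norm ?powR_ge0// ge0_ler_powR ?nnegrE//.
  + by rewrite ltW// (lt_trans ltr01).
  + by rewrite subr_ge0 ltW.
  + exact: mme_dist alpha_lt_beta hL1 hL2 _ htheta0 _.
- move=> w; rewrite Psi0E//; apply: le_trans (hC (mn w)) _.
  by rewrite ler_wpM2l// -/m mnE deviation_power_bound.
have S_ge0 j w : 0 <= S w ^+ (2 * j) by rewrite exprM exprn_ge0// sqr_ge0.
have moment_le j Cj : 0 <= Cj ->
    (\int[P]_w (S w ^+ (2 * j))%:E <= (Cj * n%:R ^+ j)%:E)%E ->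
    (\int[P]_w (S w ^+ (2 * j) / n%:R ^+ j)%:E <= Cj%:E)%E.
  move=> Cj0 hj; have nj0 : 0 < n%:R ^+ j :> R by exact: exprn_gt0.
  under eq_integral do rewrite mulrC EFinM.
  have nj1 : (0 <= (n%:R ^- j)%:E :> \bar R)%E by rewrite lee_fin invr_ge0 ltW.
  rewrite (ge0_integralZl P _ _ _ nj1)//; last 2 first.
  - by apply/measurable_EFinP; exact: measurable_funX.
  - by move=> w _; rewrite lee_fin.
  apply: le_trans (lee_wpmul2l nj1 hj) _.
  by rewrite -EFinM lee_fin mulrCA mulVf ?mulr1// gt_eqF.
have pow_ge0 j w : 0 <= S w ^+ (2 * j) / n%:R ^+ j.
  by rewrite divr_ge0 ?S_ge0// exprn_ge0// ltW.
have mpow j : measurable_fun setT (fun w => (S w ^+ (2 * j) / n%:R ^+ j)%:E).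
  by apply/measurable_EFinP; apply: measurable_funM => //; exact: measurable_funX.
under eq_integral do rewrite mulrA EFinM !EFinD.
have Cnu0 : (0 <= (C * nu)%:E)%E by rewrite lee_fin mulr_ge0.
rewrite (ge0_integralZl P _ _ _ Cnu0)//; last 2 first.
- by apply: emeasurable_funD => //; apply: emeasurable_funD.
- by move=> w _; rewrite !adde_ge0// lee_fin.
rewrite ge0_integralD//; last 3 first.
- by move=> w _; rewrite adde_ge0// lee_fin.
- by apply: emeasurable_funD.
- by move=> w _; rewrite lee_fin.
rewrite ge0_integralD//; last by move=> w _; rewrite lee_fin.
have int1 : (\int[P]_(w in setT) 1%E <= 1%:E)%E.
  by rewrite integral_cst// mul1e; exact: probability_le1.
apply: (@le_trans _ _ ((C * nu)%:E * (1 + C1 + C2)%:E)%E).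
  apply: (lee_wpmul2l Cnu0).
  rewrite !EFinD; apply: leeD; last exact: moment_le (hC2 _ _ _ _ _ n1 iidX).
  by apply: leeD => //; exact: moment_le (hC1 _ _ _ _ _ n1 iidX).
by rewrite -EFinM lee_fin mulrAC ler_wpM2r// lerDl.
Qed.
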